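(* Let $H$ be a finite dimensional semisimple Hopf algebra over $\mathbb{C}$, let $K$ be a normal Hopf subalgebra of $H$ and let $L=H//K$. Let $\mathcal{C}_1,\dots,\mathcal{C}_l$ be the equivalence classes of the equivalence relation $r^{H^*}_{L^*,k}$ on $\mathrm{Irr}(H)$ and let $a_i=\sum_{\chi\in\mathcal{C}_i}\chi(1)\chi$ for $1\le i\le l$. Then the set $\mathrm{Irr}(K)$ of irreducible characters of $K$ can be partitioned into disjoint subsets $\mathcal{A}_1,\dots,\mathcal{A}_l$ such that for every $1\le i\le l$: $$a_i\!\downarrow_K=\frac{|H|}{|K|}\sum_{\alpha\in\mathcal{A}_i}\alpha(1)\alpha ,\qquad a_i(1)=\frac{|H|}{|K|}\sum_{\alpha\in\mathcal{A}_i}\alpha(1)^2,$$ for every $\chi\in\mathcal{C}_i$ $$\chi\!\downarrow_K=\frac{\chi(1)}{a_i(1)}\,\frac{|H|}{|K|}\sum_{\alpha\in\mathcal{A}_i}\alpha(1)\alpha ,$$ and for every $\alpha\in\mathcal{A}_i$ $$\alpha\!\uparrow_K^H=\frac{\alpha(1)}{a_i(1)}\,\frac{|H|}{|K|}\sum_{\chi\in\mathcal{C}_i}\chi(1)\chi=\frac{\alpha(1)}{a_i(1)}\,\frac{|H|}{|K|}\,a_i .$$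
   Context: $k=\mathbb{C}$ and $|V|=\dim_k V$. $\mathrm{Irr}(H)$ is the set of irreducible characters of $H$; $\chi\!\downarrow_K$ denotes restriction of a character to $K$ and $\alpha\!\uparrow_K^H$ denotes the character of the induced module $H\otimes_K M$ where $M$ is a $K$-module with character $\alpha$. $H//K=H/HK^+$, where $K^+=K\cap\ker\epsilon$; since $K$ is normal this is a quotient Hopf algebra $L$ of $H$, and the projection $\pi:H\to L$ dualizes to an injective Hopf algebra map $\pi^*:L^*\to H^*$, through which $L^*$ is regarded as a Hopf subalgebra of $H^*$. For $\chi\in\mathrm{Irr}(H)$ let $C_\chi\subset H^*$ be the simple subcoalgebra of $H^*$ associated to $\chi$ (the span of the matrix coefficients of the corresponding simple $H$-module). The equivalence relation $r^{H^*}_{L^*,k}$ on $\mathrm{Irr}(H)$ is defined by: $\chi\sim\mu$ if and only if $C_\chi\subset L^*C_\mu$ (product in $H^*$). Equivalently, $m_H(\chi,t_L\mu)>0$, where $t_L\in L^*\subset H^*$ is the integral of $L^*$ with $t_L(1)=\dim_k L$ (the regular character of $L$ viewed as a character of $H$), the product is that of $H^*$, and $m_H$ is the bilinear form on the span of the characters of $H$ with $m_H(\chi_M,\chi_N)=\dim_k\mathrm{Hom}_H(M,N)$ for $H$-modules $M,N$ with characters $\chi_M,\chi_N$. *)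

(* Defs.v *)
From HB Require Import structures.
From mathcomp Require Import all_boot all_order all_algebra falgebra.
From mathcomp Require Import complex.
From mathcomp Require Import all_classical reals.

Set Implicit Arguments.
Unset Strict Implicit.
Unset Printing Implicit Defensive.

Import GRing.Theory.
Local Open Scope ring_scope.

Reserved Notation "u '⊗' v" (at level 40, left associativity).

(* U ⊗ V is modelled by the arrays of coordinates in the product of the       *)
(* standard bases vbasis {:U} and vbasis {:V}; [tlift_tens] and               *)
(* [tensor_hom_ext] are its universal property.                               *)
Section Tensor.
Variable F : fieldType.

Definition tensor (U V : vectType F) : Type :=
  'M[F]_(\dim {:U}, \dim {:V}).

HB.instance Definition _ (U V : vectType F) := Vector.on (tensor U V).

Definition tens (U V : vectType F) (u : U) (v : V) : tensor U V :=
  \matrix_(i, j) (coord (vbasis {:U}) i u * coord (vbasis {:V}) j v).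

Local Notation "u ⊗ v" := (tens u v).

Section Lift.
Variables U V W : vectType F.

Definition tlift_fun (f : U -> V -> W) (t : tensor U V) : W :=
  \sum_(i < \dim {:U}) \sum_(j < \dim {:V})
     t i j *: f (vbasis {:U})`_i (vbasis {:V})`_j.

Fact tlift_is_linear f : linear (tlift_fun f).
Proof.
move=> a s t; rewrite /tlift_fun scaler_sumr -big_split /=.
apply: eq_bigr => i _; rewrite scaler_sumr -big_split /=.
by apply: eq_bigr => j _; rewrite !mxE scalerDl scalerA.
Qed.
HB.instance Definition _ f :=
  GRing.isLinear.Build F (tensor U V) W _ (tlift_fun f) (tlift_is_linear f).

(* The linear map u ⊗ v |-> f u v induced by a bilinear f. *)
Definition tlift (f : U -> V -> W) : 'Hom(tensor U V, W) :=
  linfun (tlift_fun f).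

Lemma tlift_tens (f : U -> V -> W) u v :
    (forall x, linear (f x)) -> (forall y, linear (f^~ y)) ->
  tlift f (u ⊗ v) = f u v.
Proof.
move=> fr fl; rewrite lfunE /= /tlift_fun.
pose fR x := GRing.isLinear.Build F V W *:%R (f x) (fr x).
pose fL y := GRing.isLinear.Build F U W *:%R (f^~ y) (fl y).
pose gR x : {linear V -> W} := HB.pack (f x) (fR x).
pose gL y : {linear U -> W} := HB.pack (f^~ y) (fL y).
rewrite {2}(coord_vbasis (memvf u)).
rewrite -[RHS]/(gL v _) linear_sum; apply: eq_bigr => i _.
rewrite linearZ /= {2}(coord_vbasis (memvf v)).
rewrite -[f _ _ in RHS]/(gR _ _) linear_sum scaler_sumr.
by apply: eq_bigr => j _; rewrite linearZ /= scalerA mxE.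
Qed.

Lemma tensor_hom_ext (f g : 'Hom(tensor U V, W)) :
  (forall u v, f (u ⊗ v) = g (u ⊗ v)) -> f = g.
Proof.
move=> fg; apply/lfunP => t.
have -> : t = \sum_i \sum_j t i j *:
    ((vbasis {:U})`_i ⊗ (vbasis {:V})`_j : tensor U V).
  apply/matrixP => i j; rewrite summxE (bigD1 i) //= summxE (bigD1 j) //=.
  rewrite !mxE !coord_free ?(basis_free (vbasisP _)) // !eqxx !mulr1.
  rewrite big1 => [|k kj]; last first.
    rewrite !mxE !coord_free ?(basis_free (vbasisP _)) // eqxx.
    by rewrite (_ : (_ == _) = false) ?mulr0 //; exact: negPf kj.
  rewrite addr0 big1 ?addr0 // => k ki; rewrite summxE big1 // => l _.
  rewrite !mxE !coord_free ?(basis_free (vbasisP _)) //.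
  by rewrite (_ : (_ == _) = false) ?mul0r ?mulr0 //; exact: negPf ki.
rewrite !linear_sum; apply: eq_bigr => i _; rewrite !linear_sum.
by apply: eq_bigr => j _; rewrite !linearZ /= fg.
Qed.

End Lift.

Lemma tens_linearl (U V : vectType F) (v : V) :
  linear (fun u : U => u ⊗ v).
Proof.
by move=> a x y; apply/matrixP=> i j; rewrite !mxE linearP mulrDl mulrA.
Qed.

Lemma tens_linearr (U V : vectType F) (u : U) :
  linear (fun v : V => u ⊗ v).
Proof.
by move=> a x y; apply/matrixP=> i j; rewrite !mxE linearP mulrDr mulrCA.
Qed.

Definition tmap (U V U' V' : vectType F) (f : 'Hom(U, U')) (g : 'Hom(V, V')) :
    'Hom(tensor U V, tensor U' V') :=
  tlift (fun u v => f u ⊗ g v).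

Definition tassoc (U V W : vectType F) :
    'Hom(tensor (tensor U V) W, tensor U (tensor V W)) :=
  tlift (fun t w => tlift (fun u v => u ⊗ (v ⊗ w)) t).

(* The image of A ⊗ B in U ⊗ V. *)
Definition tensv (U V : vectType F) (A : {vspace U}) (B : {vspace V}) :
    {vspace tensor U V} :=
  <<[seq a ⊗ b | a <- vbasis A, b <- vbasis B]>>%VS.

(* (a ⊗ b) (c ⊗ d) = a c ⊗ b d *)
Definition tmul (A B : falgType F) (s t : tensor A B) : tensor A B :=
  tlift (fun a b => tlift (fun c d => (a * c) ⊗ (b * d)) t) s.

End Tensor.

Notation "u ⊗ v" := (tens u v) : ring_scope.

(* V / U is realized on the chosen complement U^C, with the projection along  *)
(* U as quotient map.                                                         *)
Section Quotient.
Variables (F : fieldType) (V : vectType F) (U : {vspace V}).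

Definition quov : vectType F := subvs_of (U^C)%VS.

Definition quov_pi : 'Hom(V, quov) :=
  (linfun (vsproj U^C) \o daddv_pi U^C U)%VF.

Definition quov_repr : 'Hom(quov, V) := linfun vsval.

Lemma quov_reprK x : quov_pi (quov_repr x) = x.
Proof.
rewrite comp_lfunE !lfunE /= daddv_pi_id ?vsvalK ?subvsP //.
by rewrite capvC capv_compl.
Qed.

Lemma quov_piK v : v - quov_repr (quov_pi v) \in U.
Proof.
rewrite comp_lfunE !lfunE /= vsprojK ?memv_pi //.
have CU0 : (U^C :&: U = 0)%VS by rewrite capvC capv_compl.
have vCU : v \in (U^C + U)%VS by rewrite addvC addv_complf memvf.
have dv := daddv_pi_add CU0 vCU; set p := daddv_pi _ _ v in dv *.
by rewrite -dv addrC addKr memv_pi.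
Qed.

Lemma quov_pi_eq0 v : (quov_pi v == 0) = (v \in U).
Proof.
apply/eqP/idP => [v0|Uv]; first by have := quov_piK v; rewrite v0 linear0 subr0.
have Ur : quov_repr (quov_pi v) \in U.
  by rewrite -[_ (_ v)](subKr v) rpredB // quov_piK.
have : quov_repr (quov_pi v) \in (U :&: U^C)%VS.
  by rewrite memv_cap Ur /= [quov_repr _]lfunE subvsP.
rewrite capv_compl memv0 => /eqP r0.
by rewrite -[LHS]quov_reprK r0 linear0.
Qed.

Lemma lker_quov_pi : lker quov_pi = U.
Proof. by apply/vspaceP => v; rewrite memv_ker quov_pi_eq0. Qed.

Lemma limg_quov_pi : limg quov_pi = fullv.
Proof.
by apply/vspaceP => x; rewrite memvf -[x]quov_reprK memv_img ?memvf.
Qed.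

End Quotient.

Section Dual.
Variable F : fieldType.

Definition dual (V : vectType F) : vectType F := 'Hom(V, F^o).

Section Transpose.
Variables (V W : vectType F) (p : 'Hom(V, W)).

Definition transpose_fun (f : dual W) : dual V := (f \o p)%VF.

Fact transpose_is_linear : linear transpose_fun.
Proof. by move=> a f g; rewrite /transpose_fun comp_lfunDl comp_lfunZl. Qed.
HB.instance Definition _ :=
  GRing.isLinear.Build F (dual W) (dual V) _ transpose_fun transpose_is_linear.

Definition transpose : 'Hom(dual W, dual V) := linfun transpose_fun.

End Transpose.
End Dual.

Section Modules.
Variable F : fieldType.

Record lmodule (A : falgType F) := LModule {
  module_space :> vectType F;
  act : 'Hom(A, 'End(module_space));
  act1 : act 1 = \1%VF;
  actM : forall x y, act (x * y) = (act x \o act y)%VF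
}.

Section Algebra.
Variable A : falgType F.

Definition submodule (M : lmodule A) (U : {vspace M}) : Prop :=
  forall a u, u \in U -> act M a u \in U.

Definition simple_module (M : lmodule A) : Prop :=
  fullv != 0%VS :> {vspace M} /\
  forall U : {vspace M}, submodule U -> U = 0%VS \/ U = fullv.

Definition semisimple_module (M : lmodule A) : Prop :=
  forall U : {vspace M}, submodule U ->
    exists W : {vspace M},
      [/\ submodule W, (U + W)%VS = fullv & (U :&: W)%VS = 0%VS].

Fact regular_act1 : linfun (@amull F A) 1 = \1%VF.
Proof. by rewrite lfunE /= amull1. Qed.

Fact regular_actM x y : linfun (@amull F A) (x * y) =
  (linfun (@amull F A) x \o linfun (@amull F A) y)%VF.
Proof.
rewrite !(lfunE (@amull F A)); apply/lfunP=> z.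
by rewrite !lfunE /= !lfunE /= mulrA.
Qed.

Definition regular : lmodule A := LModule regular_act1 regular_actM.

(* For a finite-dimensional algebra, submodules of the regular module are the
   left ideals. *)
Definition semisimple_algebra : Prop := semisimple_module regular.

Definition lfun_trace (V : vectType F) (f : 'End(V)) : F^o :=
  \sum_(i < \dim {:V}) coord (vbasis {:V}) i (f (vbasis {:V})`_i).

Definition character_fun (M : lmodule A) (x : A) : F^o :=
  lfun_trace (act M x).

Fact character_is_linear M : linear (character_fun M).
Proof.
move=> a x y; rewrite /character_fun /lfun_trace scaler_sumr -big_split /=.
by apply: eq_bigr => i _; rewrite linearP add_lfunE scale_lfunE linearP.
Qed.
HB.instance Definition _ M :=
  GRing.isLinear.Build F A F^o _ (character_fun M) (character_is_linear M).

Definition character (M : lmodule A) : dual A := linfun (character_fun M).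

Definition Irr : set (dual A) :=
  [set chi | exists M, simple_module M /\ character M = chi].

Definition mcoef_fun (M : lmodule A) (i j : 'I_(\dim {:M})) (x : A) : F^o :=
  coord (vbasis {:M}) i (act M x (vbasis {:M})`_j).

Fact mcoef_is_linear M i j : linear (@mcoef_fun M i j).
Proof.
by move=> a x y; rewrite /mcoef_fun linearP add_lfunE scale_lfunE linearP.
Qed.
HB.instance Definition _ M i j :=
  GRing.isLinear.Build F A F^o _ (@mcoef_fun M i j) (mcoef_is_linear i j).

(* The subcoalgebra of A^* spanned by the matrix coefficients of M. *)
Definition coefs (M : lmodule A) : {vspace dual A} :=
  <<[seq linfun (@mcoef_fun M i j) | i <- enum 'I_(\dim {:M}),
                                     j <- enum 'I_(\dim {:M})]>>%VS.

End Algebra.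

Section Induction.
Variables (A : falgType F) (B : {aspace A}).

Definition res (f : dual A) : dual (subvs_of B) :=
  (f \o linfun vsval)%VF.

Variable M : lmodule (subvs_of B).

(* The span of the a b ⊗ m - a ⊗ b m; as these are linear in b, it suffices   *)
(* to let b range over a basis of B.                                          *)
Definition balancing : {vspace tensor A M} :=
  (\sum_(b <- vbasis {:subvs_of B})
     limg (tlift (fun (a : A) (m : M) =>
                    (a * vsval b) ⊗ m - a ⊗ act M b m)))%VS.

(* A ⊗_B M *)
Definition btensor : vectType F := quov balancing.

Definition btens (a : A) (m : M) : btensor := quov_pi balancing (a ⊗ m).

Definition ind_lmul (a : A) : 'End(tensor A M) :=
  tlift (fun x m => (a * x) ⊗ m).

Lemma ind_lmulE a x m : ind_lmul a (x ⊗ m) = (a * x) ⊗ m.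
Proof.
rewrite tlift_tens // => [y|y]; first exact: tens_linearr.
by move=> c u v; rewrite mulrDr -scalerAr tens_linearl.
Qed.

Lemma balanceE b a m :
  tlift (fun (a : A) (m : M) => (a * vsval b) ⊗ m - a ⊗ act M b m) (a ⊗ m)
  = (a * vsval b) ⊗ m - a ⊗ act M b m.
Proof.
rewrite tlift_tens // => [x|x] c u v.
  by rewrite linearP !tens_linearr scalerBr opprD addrACA.
by rewrite mulrDl -scalerAl !tens_linearl scalerBr opprD addrACA.
Qed.

Lemma ind_lmul_balancing a : (ind_lmul a @: balancing <= balancing)%VS.
Proof.
rewrite {1}/balancing limg_sum big_seq.
elim/big_rec: _ => [|b U rb UB]; first exact: sub0v.
rewrite subv_add UB andbT -limg_comp.
set T := tlift _.
have -> : (ind_lmul a \o T = T \o ind_lmul a)%VF.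
  apply: tensor_hom_ext => x m; rewrite !comp_lfunE ind_lmulE !balanceE.
  by rewrite linearB /= !ind_lmulE mulrA.
rewrite limg_comp (subv_trans (limgS _ (subvf _))) //.
by rewrite /balancing (big_rem b) //= addvSl.
Qed.

Definition ind_act_fun (a : A) : 'End(btensor) :=
  (quov_pi balancing \o ind_lmul a \o quov_repr balancing)%VF.

Fact ind_act_is_linear : linear ind_act_fun.
Proof.
move=> c x y; rewrite /ind_act_fun.
have -> : ind_lmul (c *: x + y) = c *: ind_lmul x + ind_lmul y.
  apply: tensor_hom_ext => z m.
  by rewrite add_lfunE scale_lfunE !ind_lmulE mulrDl -scalerAl tens_linearl.
by rewrite comp_lfunDr -comp_lfunZr comp_lfunDl -comp_lfunZl.
Qed.
HB.instance Definition _ :=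
  GRing.isLinear.Build F A 'End(btensor) _ ind_act_fun ind_act_is_linear.

Lemma ind_act_pi a t :
  linfun ind_act_fun a (quov_pi balancing t) = quov_pi balancing (ind_lmul a t).
Proof.
have -> u : linfun ind_act_fun a u
    = quov_pi balancing (ind_lmul a (quov_repr balancing u)).
  by rewrite lfunE /= !comp_lfunE.
apply/eqP.
rewrite -subr_eq0 -(linearB (quov_pi balancing)) -(linearB (ind_lmul a)) /=.
rewrite quov_pi_eq0 (subvP (ind_lmul_balancing a)) // memv_img //.
by rewrite -opprB rpredN quov_piK.
Qed.

Lemma ind_actE a x m : linfun ind_act_fun a (btens x m) = btens (a * x) m.
Proof. by rewrite ind_act_pi ind_lmulE. Qed.

Fact ind_act1 : linfun ind_act_fun 1 = \1%VF.
Proof.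
have l1 : ind_lmul 1 = \1%VF.
  by apply: tensor_hom_ext => x m; rewrite ind_lmulE mul1r id_lfunE.
by apply/lfunP=> x; rewrite -[x]quov_reprK ind_act_pi l1 !id_lfunE.
Qed.

Fact ind_actM x y :
  linfun ind_act_fun (x * y) =
  (linfun ind_act_fun x \o linfun ind_act_fun y)%VF.
Proof.
have lM : ind_lmul (x * y) = (ind_lmul x \o ind_lmul y)%VF.
  by apply: tensor_hom_ext => z m; rewrite comp_lfunE !ind_lmulE mulrA.
by apply/lfunP=> t; rewrite -[t]quov_reprK comp_lfunE !ind_act_pi lM comp_lfunE.
Qed.

(* The A-module A ⊗_B M, on which a (x ⊗ m) = (a x) ⊗ m by [ind_actE]. *)
Definition induced : lmodule A := LModule ind_act1 ind_actM.

End Induction.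
End Modules.

Arguments Irr {F} A _.
Arguments res {F A} B f.

HB.mixin Record isHopfAlgebra (F : fieldType) H of Falgebra F H := {
  comul : 'Hom(H, tensor H H);
  counit : 'Hom(H, F^o);
  antipode : 'End(H);
  comulA : (tassoc H H H \o tmap comul \1 \o comul)%VF
           = (tmap \1 comul \o comul)%VF;
  counitl : (tlift (fun x y => counit x *: y) \o comul)%VF = \1%VF;
  counitr : (tlift (fun x y => counit y *: x) \o comul)%VF = \1%VF;
  comul1 : comul 1 = 1 ⊗ 1;
  comulM : forall x y, comul (x * y) = tmul (comul x) (comul y);
  counit1 : counit 1 = 1;
  counitM : forall x y, counit (x * y) = counit x * counit y;
  antipodel : forall x,
    tlift (fun a b => antipode a * b) (comul x) = counit x *: 1;
  antipoder : forall x,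
    tlift (fun a b => a * antipode b) (comul x) = counit x *: 1
}.

#[short(type="hopfAlgType")]
HB.structure Definition HopfAlgebra (F : fieldType) :=
  { H of isHopfAlgebra F H & Falgebra F H }.

Section Hopf.
Variables (F : fieldType) (H : hopfAlgType F).

(* An {aspace H} may have a unit other than 1, whence the first condition. *)
Definition hopf_subalgebra (K : {aspace H}) : Prop :=
  [/\ 1 \in K, (comul @: K <= tensv K K)%VS & (antipode @: K <= K)%VS].

(* Stability under the left and right adjoint actions
   x |-> h_1 x S(h_2) and x |-> S(h_1) x h_2. *)
Definition normal_subspace (K : {vspace H}) : Prop :=
  forall h x : H, x \in K ->
    tlift (fun a b => a * x * antipode b) (comul h) \in K /\
    tlift (fun a b => antipode a * x * b) (comul h) \in K.

(* The product of H^*: (f g)(h) = f(h_1) g(h_2). *)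
Definition convolution (f g : dual H) : dual H :=
  (tlift (fun x y => f x * g y : F^o) \o comul)%VF.

Definition convolutionv (U W : {vspace dual H}) : {vspace dual H} :=
  <<[seq convolution f g | f <- vbasis U, g <- vbasis W]>>%VS.

Section Quotient.
Variable K : {aspace H}.

(* H K^+ *)
Definition augmentation_ideal : {vspace H} :=
  ({:H} * (K :&: lker counit))%VS.

(* H // K *)
Definition hopf_quotient : vectType F := quov augmentation_ideal.

Definition hopf_proj : 'Hom(H, hopf_quotient) := quov_pi augmentation_ideal.

(* L^* for L = H // K, inside H^* through the transpose of H -> L. Only the
   subspace matters below, so L is kept as a mere quotient space: for normal K
   it carries the Hopf structure for which H -> L is a Hopf algebra map. *)
Definition quotient_dual : {vspace dual H} := limg (transpose hopf_proj).

(* The relation r^{H^*}_{L^*,k}; C_chi is the coefficient coalgebra of any    *)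
(* simple module with character chi.                                          *)
Definition coset_rel (chi mu : dual H) : Prop :=
  exists M N : lmodule H,
    [/\ simple_module M /\ character M = chi,
        simple_module N /\ character N = mu &
        (coefs M <= convolutionv quotient_dual (coefs N))%VS].

Definition coset_class (chi : dual H) : set (dual H) :=
  [set mu | Irr H mu /\ coset_rel mu chi].

End Quotient.
End Hopf.

(* Main.v *)
(* The coset relation says that two irreducible H-characters have a common     *)
(* K-constituent: a nonzero K-map phi : N -> M gives                           *)
(* m*(h phi(n)) = m*(h_1 phi S(h_2) (h_3 n)), whose first factor lies in L^*,  *)
(* while elements of L^* restrict to multiples of the counit on K.             *)
(* Tensoring with H // K multiplies restrictions to K by dim L, so the numbers *)
(* chi(1) and <chi|K, alpha> are eigenvectors of the matrix of that operator   *)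
(* on Irr(H), which has positive entries between characters with a common      *)
(* constituent. A maximum principle then makes <chi|K, alpha> / chi(1) constant*)
(* on the characters containing alpha, so equivalent characters have           *)
(* proportional restrictions. A second use of the maximum principle shows that *)
(* H restricted to K is a multiple of the regular module, which determines     *)
(* the constants; the induced characters follow by Frobenius reciprocity.      *)
(* Semisimplicity of K comes from an integral t of K: if eps(t) = 0 for all    *)
(* such t then normality gives t h t = 0 for all h in H.                       *)

From HB Require Import structures.
Require Import Defs.
From mathcomp Require Import all_boot all_order all_algebra falgebra.
From mathcomp Require Import complex.
From mathcomp Require Import all_classical reals.
From mathcomp Require Import ring.
Set Implicit Arguments.
Unset Strict Implicit.
Unset Printing Implicit Defensive.
Import GRing.Theory.
Local Open Scope ring_scope.

(** * Traces *)

(** Let p_j be the degree of the irreducible H-module [M j], d_a that of the irreducible K-module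
    [V a], and q_aj the multiplicity of [V a] in the restriction of [M j]. The theorem amounts to
    q_aj = p_j d_a |H| / (|K| a_i(1)) whenever [M j] belongs to the i-th class and q_aj > 0
    ([res_mult_class]): for fixed j this gives the restriction formula and, through Frobenius
    reciprocity ([hdim_induced]), for fixed a the induction formula.

    Three facts give this value. The coset relation is the relation [share] of having a common
    constituent on K ([coset_relP]). Characters related by [share] have proportional restrictions
    ([share_proportional]). Finally sum_j p_j q_aj = d_a |H| / |K|, because H is a multiple of the
    regular K-module ([regular_multiplicity], [sum_res_mult]). Proportionality reduces this last sum
    to a multiple of q_aj.

    Orthogonality of characters for K comes from an integral t of K with eps(t) = 1
    ([sub_integral]). The tensor t_1 ⊗ S(t_2) averages linear maps into intertwiners, and the trace
    of that projection is the inner product of two characters ([ip_character]). *)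

Section Trace.
Variable F : fieldType.

Fact lfun_trace_is_linear (V : vectType F) : linear (@lfun_trace F V).
Proof.
move=> a f g; rewrite /lfun_trace scaler_sumr -big_split /=.
by apply: eq_bigr => i _; rewrite add_lfunE scale_lfunE linearP.
Qed.
HB.instance Definition _ (V : vectType F) :=
  GRing.isLinear.Build F 'End(V) F^o _ (@lfun_trace F V)
    (@lfun_trace_is_linear V).

Lemma lfun_traceC (V W : vectType F) (f : 'Hom(V, W)) (g : 'Hom(W, V)) :
  lfun_trace (f \o g)%VF = lfun_trace (g \o f)%VF.
Proof.
transitivity (\sum_(i < \dim {:W}) \sum_(j < \dim {:V}) coord (vbasis {:V}) j
  (g (vbasis {:W})`_i) *
                coord (vbasis {:W}) i (f (vbasis {:V})`_j)).
  apply: eq_bigr => i _; rewrite comp_lfunE.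
  rewrite {1}(coord_vbasis (memvf (g _))) !linear_sum.
  by apply: eq_bigr => j _; rewrite !linearZ.
rewrite exchange_big /=; apply: eq_bigr => j _; rewrite comp_lfunE.
rewrite {2}(coord_vbasis (memvf (f _))) !linear_sum.
by apply: eq_bigr => i _; rewrite !linearZ mulrC.
Qed.

Lemma lfun_trace_id (V : vectType F) : lfun_trace (\1%VF : 'End(V)) = (\dim
  {:V})%:R.
Proof.
rewrite /lfun_trace (eq_bigr (fun=> 1)) => [|i _]; last first.
  by rewrite id_lfunE coord_free ?(basis_free (vbasisP _)) // eqxx.
by rewrite sumr_const card_ord.
Qed.

(** [e] and [f] need only reconstruct every vector. On ['Hom(V, W)] and on [tensor V W] they are
    taken to be the matrix units and their coordinate functionals. *)
Lemma lfun_trace_dual_system (V : vectType F) (I : Type) (s : seq I)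
    (e : I -> V) (f : I -> 'Hom(V, F^o)) (T : 'End(V)) :
  (forall x, x = \sum_(i <- s) f i x *: e i) ->
  lfun_trace T = \sum_(i <- s) f i (T (e i)).
Proof.
move=> ef; rewrite /lfun_trace.
under eq_bigr => j _ do rewrite {1}(ef (vbasis {:V})`_j) !linear_sum.
rewrite exchange_big /=; apply: eq_bigr => i _.
rewrite [in RHS](coord_vbasis (memvf (T (e i)))) linear_sum.
by apply: eq_bigr => j _; rewrite !linearZ /= [LHS]mulrC.
Qed.

Lemma lfun_trace_proj (V : vectType F) (U : {vspace V}) (p : 'End(V)) :
  (forall x, p x \in U) -> (forall x, x \in U -> p x = x) ->
  lfun_trace p = (\dim U)%:R.
Proof.
move=> pU pid.
pose f : 'Hom(V, subvs_of U) := (linfun (vsproj U) \o p)%VF.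
pose g : 'Hom(subvs_of U, V) := linfun vsval.
have gf : (g \o f)%VF = p.
  by apply/lfunP => x; rewrite !comp_lfunE !lfunE /= vsprojK.
have fg : (f \o g)%VF = \1%VF.
  apply/lfunP => x; rewrite !comp_lfunE !lfunE /= pid ?subvsP //.
  by rewrite vsvalK.
by rewrite -gf lfun_traceC fg lfun_trace_id dimvf /dim /=.
Qed.

Lemma lfunZ (V W : vectType F) (f : 'Hom(V, W)) c x : f (c *: x) = c *: f x.
Proof. exact: linearZ. Qed.

Lemma lfunD (V W : vectType F) (f : 'Hom(V, W)) x y : f (x + y) = f x + f y.
Proof. exact: linearD. Qed.

Lemma lfunB (V W : vectType F) (f : 'Hom(V, W)) x y : f (x - y) = f x - f y.
Proof. exact: linearB. Qed.

Lemma lfun_sum (V W : vectType F) (f : 'Hom(V, W)) (I : Type) (r : seq I) u :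
  f (\sum_(i <- r) u i) = \sum_(i <- r) f (u i).
Proof. exact: linear_sum. Qed.

Definition sandwich (V W V' W' : vectType F) (a : 'Hom(W, W')) (b : 'Hom(V', V))
  (f : 'Hom(V, W)) : 'Hom(V', W') := (a \o f \o b)%VF.

Fact sandwich_is_linear (V W V' W' : vectType F) (a : 'Hom(W, W'))
  (b : 'Hom(V', V)) : linear (sandwich a b).
Proof.
by move=> c f g; rewrite /sandwich comp_lfunDr comp_lfunDl -comp_lfunZr
  -comp_lfunZl.
Qed.
HB.instance Definition _ (V W V' W' : vectType F) (a : 'Hom(W, W'))
    (b : 'Hom(V', V)) :=
  GRing.isLinear.Build F 'Hom(V, W) 'Hom(V', W') _ (sandwich a b)
    (sandwich_is_linear a b).

Definition rank1 (V W : vectType F) (v : 'Hom(V, F^o)) (w : W) : 'Hom(V, W) :=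
  linfun (fun x => v x *: w).

(** Serves functions whose linearity is proved on the spot and not registered as an instance. *)
Lemma linfunE (V W : vectType F) (f : V -> W) :
  linear f -> linfun f =1 f.
Proof.
move=> fl x; pose g : {linear V -> W} := HB.pack f (GRing.isLinear.Build F V W
  _ f fl).
by rewrite -[f in linfun f]/(g : V -> W) lfunE.
Qed.

Lemma rank1E (V W : vectType F) (v : 'Hom(V, F^o)) (w : W) x :
  rank1 v w x = v x *: w.
Proof.
by apply: linfunE => c y z; rewrite linearP scalerDl scalerA.
Qed.

(** The diagonal entry at the matrix unit (i, j) is a_ii b_jj. This is what turns the trace of an
    averaging operator into products of characters. *)
Lemma lfun_trace_sandwich (V W : vectType F) (a : 'End(W)) (b : 'End(V)) :
  lfun_trace (linfun (sandwich a b)) = lfun_trace a * lfun_trace b.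
Proof.
pose cW i : 'Hom(W, F^o) := linfun (coord (vbasis {:W}) i : W -> F^o).
pose cV i : 'Hom(V, F^o) := linfun (coord (vbasis {:V}) i : V -> F^o).
pose e (p : 'I_(\dim {:W}) * 'I_(\dim {:V})) : 'Hom(V, W) :=
  rank1 (cV p.2) (vbasis {:W})`_p.1.
pose h (p : 'I_(\dim {:W}) * 'I_(\dim {:V})) (f : 'Hom(V, W)) : F^o :=
  cW p.1 (f (vbasis {:V})`_p.2).
have hl p : linear (h p).
  by move=> c f g; rewrite /h add_lfunE scale_lfunE linearP.
rewrite (@lfun_trace_dual_system _ _ (index_enum _) e (fun p => linfun (h p))).
  rewrite /lfun_trace big_distrlr /= pair_big /=.
  apply: eq_bigr => -[i j] _; rewrite (linfunE (hl _)) lfunE /= /h /= /sandwich.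
  by rewrite !comp_lfunE rank1E !linearZ /= !lfunE /= mulrC.
move=> f; apply/lfunP => x; rewrite sum_lfunE.
rewrite -(pair_big xpredT xpredT (fun i j => (linfun (h (i, j)) f *: e (i, j))
  x)) /=.
rewrite exchange_big /= {1}(coord_vbasis (memvf x)) linear_sum;
  apply: eq_bigr => j _.
rewrite linearZ /= {1}(coord_vbasis (memvf (f _))) scaler_sumr.
apply: eq_bigr => i _;
  rewrite scale_lfunE rank1E (linfunE (hl _)) /h /= !lfunE /=.
by rewrite !scalerA mulrC.
Qed.

Lemma tmapE (U V U' V' : vectType F) (f : 'Hom(U, U')) (g : 'Hom(V, V')) u v :
  tmap f g (u ⊗ v) = f u ⊗ g v.
Proof.
rewrite /tmap tlift_tens // => [x|y] c a b; rewrite linearP.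
  exact: tens_linearr.
exact: tens_linearl.
Qed.

Lemma lfun_trace_tmap (V W : vectType F) (a : 'End(V)) (b : 'End(W)) :
  lfun_trace (tmap a b) = lfun_trace a * lfun_trace b.
Proof.
have bl (c : 'I_(\dim {:V}) * 'I_(\dim {:W})) :
  linear (fun t : tensor V W => t c.1 c.2 : F^o).
  by move=> k s t; rewrite !mxE.
rewrite (@lfun_trace_dual_system _ _ (index_enum _)
   (fun c : 'I_(\dim {:V}) * 'I_(\dim {:W}) =>
      (vbasis {:V})`_c.1 ⊗ (vbasis {:W})`_c.2)
   (fun c => linfun (fun t : tensor V W => t c.1 c.2 : F^o))).
  rewrite /lfun_trace big_distrlr /= pair_big /=.
  by apply: eq_bigr => -[i j] _; rewrite (linfunE (bl _)) /= tmapE mxE.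
move=> t; under eq_bigr => c _ do rewrite (linfunE (bl _)).
rewrite -(pair_big xpredT xpredT (fun i j => t i j *: ((vbasis {:V})`_i ⊗
  (vbasis {:W})`_j))) /=.
apply/matrixP => i j; rewrite summxE (bigD1 i) //= summxE (bigD1 j) //=.
rewrite !mxE !coord_free ?(basis_free (vbasisP _)) // !eqxx !mulr1.
rewrite big1 => [|k kj]; last first.
  rewrite !mxE !coord_free ?(basis_free (vbasisP _)) // eqxx.
  by rewrite (_ : (_ == _) = false) ?mulr0 //; exact: negPf kj.
rewrite addr0 big1 ?addr0 // => k ki; rewrite summxE big1 // => l _.
rewrite !mxE !coord_free ?(basis_free (vbasisP _)) //.
by rewrite (_ : (_ == _) = false) ?mul0r ?mulr0 //; exact: negPf ki.
Qed.

End Trace.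

(** * Modules over separable algebras *)

Definition bilinear_fun (F : fieldType) (U V W : vectType F) (f : U -> V -> W)
  :=
  (forall u, linear (f u)) /\ (forall v, linear (f^~ v)).

Section ModuleTheory.
Variables (F : fieldType) (A : falgType F).
Implicit Types M N : lmodule A.

Definition intertwiner M N (f : 'Hom(M, N)) : Prop :=
  forall a x, f (act M a x) = act N a (f x).

Lemma act1E M x : act M 1 x = x.
Proof. by rewrite act1 id_lfunE. Qed.

Lemma actME M a b x : act M (a * b) x = act M a (act M b x).
Proof. by rewrite actM comp_lfunE. Qed.

Lemma characterE M a : character M a = lfun_trace (act M a).
Proof. by rewrite lfunE. Qed.

Lemma character1 M : character M 1 = (\dim {:M})%:R.
Proof. by rewrite characterE act1 lfun_trace_id. Qed.

Lemma character_iso M N (f : 'Hom(M, N)) (g : 'Hom(N, M)) :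
  intertwiner f -> cancel f g -> cancel g f -> character M = character N.
Proof.
move=> fi fK gK; apply/lfunP => a; rewrite !characterE.
have -> : act N a = (f \o act M a \o g)%VF.
  by apply/lfunP => x; rewrite !comp_lfunE fi gK.
rewrite lfun_traceC; congr lfun_trace.
by apply/lfunP => x; rewrite !comp_lfunE fK.
Qed.

Section Submodule.
Variables (M : lmodule A) (U : {vspace M}).
Hypothesis sU : submodule U.

Definition sub_act_fun (a : A) : 'End(subvs_of U) :=
  (linfun (vsproj U) \o act M a \o linfun vsval)%VF.

Lemma sub_act_funE a u : vsval (sub_act_fun a u) = act M a (vsval u).
Proof. by rewrite !comp_lfunE !lfunE /= vsprojK // sU // subvsP. Qed.

Fact sub_act_is_linear : linear sub_act_fun.
Proof.
by move=> c a b; rewrite /sub_act_fun linearP comp_lfunDr comp_lfunDl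
  -comp_lfunZr -comp_lfunZl.
Qed.

Fact sub_act1 : linfun sub_act_fun 1 = \1%VF.
Proof.
apply/lfunP => u; rewrite (linfunE sub_act_is_linear) id_lfunE.
by apply: subvs_inj; rewrite sub_act_funE act1E.
Qed.

Fact sub_actM x y : linfun sub_act_fun (x * y) =
  (linfun sub_act_fun x \o linfun sub_act_fun y)%VF.
Proof.
apply/lfunP => u; rewrite comp_lfunE !(linfunE sub_act_is_linear).
by apply: subvs_inj; rewrite !sub_act_funE actME.
Qed.

Definition submod : lmodule A := LModule sub_act1 sub_actM.

Lemma submod_actE a (u : submod) : vsval (act submod a u) = act M a (vsval u).
Proof. by rewrite /= (linfunE sub_act_is_linear) sub_act_funE. Qed.

End Submodule.

(** The identity is the sum of the two projections; each factors through its submodule, so cyclicity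
    moves its share of the trace there. *)
Lemma character_dsum M (U W : {vspace M}) (sU : submodule U) (sW : submodule W)
  :
  (U + W)%VS = fullv -> (U :&: W)%VS = 0%VS ->
  character M = character (submod sU) + character (submod sW).
Proof.
move=> UW UW0; apply/lfunP => a; rewrite add_lfunE !characterE.
have WU0 : (W :&: U)%VS = 0%VS by rewrite capvC.
have key (V X : {vspace M}) (sV : submodule V) : (V :&: X)%VS = 0%VS ->
  lfun_trace (act M a \o daddv_pi V X)%VF = lfun_trace (act (submod sV) a).
  move=> VX0.
  pose p : 'Hom(M, submod sV) := (linfun (vsproj V) \o daddv_pi V X)%VF.
  pose i : 'Hom(submod sV, M) := linfun vsval.
  have iE u : i u = vsval u by rewrite lfunE.
  have pE x : vsval (p x) = daddv_pi V X x.
    by rewrite comp_lfunE [linfun _ _]lfunE /= vsprojK // memv_pi.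
  clearbody i p.
  have -> : (act M a \o daddv_pi V X)%VF = (i \o (act (submod sV) a \o p))%VF.
    by apply/lfunP => x; rewrite !comp_lfunE iE submod_actE pE.
  have pi : (p \o i)%VF = \1%VF.
    apply/lfunP => x; rewrite comp_lfunE id_lfunE; apply: subvs_inj.
    by rewrite pE iE daddv_pi_id ?subvsP.
  by rewrite lfun_traceC -comp_lfunA pi comp_lfun1r.
rewrite -(key _ _ _ UW0) -(key _ _ _ WU0) -linearD /=; congr lfun_trace.
apply/lfunP => x; rewrite add_lfunE !comp_lfunE -linearD /=.
by rewrite daddv_pi_add // UW memvf.
Qed.

Lemma lker_submodule M N (f : 'Hom(M, N)) : intertwiner f -> submodule (lker f).
Proof. by move=> fi a u; rewrite !memv_ker fi => /eqP ->; rewrite linear0. Qed.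

Lemma limg_submodule M N (f : 'Hom(M, N)) : intertwiner f -> submodule (limg f).
Proof.
by move=> fi a u /memv_imgP[x _ ->]; rewrite -fi memv_img // memvf.
Qed.

Lemma Schur_inj M N (f : 'Hom(M, N)) :
  simple_module M -> intertwiner f -> f != 0 -> lker f = 0%VS.
Proof.
move=> [_ sM] fi f0; case: (sM _ (lker_submodule fi)) => // kf.
by case/negP: f0; apply/eqP/lfunP => x; apply/eqP;
  rewrite zero_lfunE -memv_ker kf memvf.
Qed.

Lemma Schur_surj M N (f : 'Hom(M, N)) :
  simple_module N -> intertwiner f -> f != 0 -> limg f = fullv.
Proof.
move=> [_ sN] fi f0; case: (sN _ (limg_submodule fi)) => // lf.
case/negP: f0; apply/eqP/lfunP => x; apply/eqP.
by rewrite zero_lfunE -memv0 -lf memv_img ?memvf.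
Qed.

Lemma Schur_character M N (f : 'Hom(M, N)) :
  simple_module M -> simple_module N -> intertwiner f -> f != 0 ->
  character M = character N.
Proof.
move=> sM sN fi f0; have k0 := Schur_inj sM fi f0;
  have im := Schur_surj sN fi f0.
apply: (@character_iso _ _ f f^-1%VF fi) => x.
  by apply: lker0_lfunK; apply/eqP.
have /memv_imgP[y _ ->] : x \in limg f by rewrite im memvf.
by rewrite lker0_lfunK //; apply/eqP.
Qed.

End ModuleTheory.

(** A separability element e' ⊗ e'', given by a list of its terms. The identity a e' ⊗ e'' = e' ⊗
    e'' a is tested on bilinear maps, which avoids computing in the tensor product. *)
Record separability (F : fieldType) (A : falgType F) := Separability {
  sep_pairs :> seq (A * A);
  sep_mul : \sum_(p <- sep_pairs) p.1 * p.2 = 1;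
  sep_comm : forall (W : vectType F) (f : A -> A -> W) a, bilinear_fun f ->
    \sum_(p <- sep_pairs) f (a * p.1) p.2 = \sum_(p <- sep_pairs) f p.1 (p.2 *
      a)
}.

Section Separable.
Variables (F : fieldType) (A : falgType F) (e : separability A).
Implicit Types M N : lmodule A.

(** The projection f |-> e' f e'' of ['Hom(M, N)] onto the intertwiners; [hdim] is thus the
    dimension of Hom_A(M, N). *)
Definition avg M N : 'End('Hom(M, N)) :=
  \sum_(p <- e) linfun (sandwich (act N p.1) (act M p.2)).

Lemma avgE M N f : avg M N f = \sum_(p <- e) (act N p.1 \o f \o act M p.2)%VF.
Proof. by rewrite sum_lfunE; apply: eq_bigr => p _; rewrite lfunE. Qed.

Lemma avgxE M N f x : avg M N f x = \sum_(p <- e) act N p.1 (f (act M p.2 x)).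
Proof.
by rewrite avgE sum_lfunE; apply: eq_bigr => p _; rewrite !comp_lfunE.
Qed.

Lemma avg_intertwiner M N f : intertwiner (avg M N f).
Proof.
move=> a x; rewrite !avgxE linear_sum /=.
under [RHS]eq_bigr => p _ do rewrite -actME.
under [LHS]eq_bigr => p _ do rewrite -actME.
symmetry; apply: (sep_comm e (f := fun a b => act N a (f (act M b x)))).
by split=> u c v w; rewrite !(linearP, add_lfunE, scale_lfunE).
Qed.

Lemma avg_id M N f : intertwiner f -> avg M N f = f.
Proof.
move=> fi; apply/lfunP => x; rewrite avgxE.
under eq_bigr => p _ do rewrite fi -actME.
rewrite -sum_lfunE -linear_sum /= sep_mul act1E //.
Qed.

Definition hdim M N := \dim (limg (avg M N)).

Definition ip (f g : dual A) : F := \sum_(p <- e) f p.1 * g p.2.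

(* The averaging map is a projection onto the intertwiners, so its trace is    *)
(* their dimension.                                                            *)
Lemma ip_character M N : ip (character N) (character M) = (hdim M N)%:R.
Proof.
rewrite /hdim -(@lfun_trace_proj _ _ (limg (avg M N)) (avg M N)).
- rewrite linear_sum; apply: eq_bigr => p _ /=.
  by rewrite lfun_trace_sandwich !characterE.
- by move=> f; rewrite memv_img ?memvf.
move=> _ /memv_imgP[g _ ->]; rewrite avg_id //; exact: avg_intertwiner.
Qed.

Lemma mem_limg_avg M N f : reflect (intertwiner f) (f \in limg (avg M N)).
Proof.
apply: (iffP idP) => [/memv_imgP[g _ ->]|fi]; first exact: avg_intertwiner.
by rewrite -(avg_id fi) memv_img ?memvf.
Qed.

Lemma hdim_gt0 M N f : @intertwiner _ _ M N f -> f != 0 -> (0 < hdim M N)%N.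
Proof.
move=> /mem_limg_avg fi f0; rewrite lt0n dimv_eq0; apply: contraNN f0 => /eqP E.
by rewrite -memv0 -E.
Qed.

Lemma hdim_gt0P M N : (0 < hdim M N)%N ->
  exists2 f, @intertwiner _ _ M N f & f != 0.
Proof.
rewrite lt0n dimv_eq0 => n0; exists (vpick (limg (avg M N)));
  last by rewrite vpick0.
by apply/mem_limg_avg; exact: memv_pick.
Qed.

Lemma hdim_eq0 M N f : hdim M N = 0%N -> avg M N f = 0.
Proof.
by move/eqP; rewrite dimv_eq0 => /eqP E; apply/eqP;
  rewrite -memv0 -E memv_img ?memvf.
Qed.

Lemma ip_is_linearl g : linear (ip ^~ g : dual A -> F^o).
Proof.
move=> c f1 f2; rewrite /ip scaler_sumr -big_split /=; apply: eq_bigr => p _.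
by rewrite add_lfunE scale_lfunE mulrDl scalerAl.
Qed.

Lemma ip_is_linearr f : linear (ip f : dual A -> F^o).
Proof.
move=> c g1 g2; rewrite /ip scaler_sumr -big_split /=; apply: eq_bigr => p _.
by rewrite add_lfunE scale_lfunE mulrDr scalerAr.
Qed.

HB.instance Definition _ f :=
  GRing.isLinear.Build F (dual A) F^o _ (ip f) (ip_is_linearr f).

Lemma ip_suml (I : Type) (r : seq I) (P : pred I) (c : I -> F) (f : I -> dual
  A) g :
  ip (\sum_(i <- r | P i) c i *: f i) g = \sum_(i <- r | P i) c i * ip (f i) g.
Proof.
pose L : {linear dual A -> F^o} :=
  HB.pack (ip ^~ g) (GRing.isLinear.Build F (dual A) F^o _ _ (ip_is_linearl g)).
by rewrite -[LHS]/(L _) linear_sum; apply: eq_bigr => i _; rewrite linearZ.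
Qed.

Lemma ip_sumr (I : Type) (r : seq I) (P : pred I) (c : I -> F) (f : I -> dual
  A) g :
  ip g (\sum_(i <- r | P i) c i *: f i) = \sum_(i <- r | P i) c i * ip g (f i).
Proof. by rewrite linear_sum; apply: eq_bigr => i _; rewrite linearZ. Qed.

(** Maschke's argument: the average of a linear projection onto [U] is an intertwiner that still
    projects onto [U]; its kernel is the complement. *)
Lemma submodule_compl M (U : {vspace M}) : submodule U ->
  exists W : {vspace M},
    [/\ submodule W, (U + W)%VS = fullv & (U :&: W)%VS = 0%VS].
Proof.
move=> sU; pose q := avg M M (projv U).
have qi : intertwiner q by exact: avg_intertwiner.
have qU x : q x \in U.
  by rewrite /q avgxE rpred_sum // => p _; rewrite sU // memv_proj.
have qid x : x \in U -> q x = x.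
  move=> xU; rewrite /q avgxE.
  under eq_bigr => p _ do rewrite projv_id ?sU // -actME.
  by rewrite -sum_lfunE -linear_sum /= sep_mul act1E.
exists (lker q); split; first exact: lker_submodule.
  apply/vspaceP => x; rewrite [RHS]memvf; apply/memv_addP.
  exists (q x); first exact: qU.
  exists (x - q x); last by rewrite addrC subrK.
  by rewrite memv_ker linearB /= (qid (q x)) ?subrr ?qU.
apply/eqP; rewrite -subv0; apply/subvP => x; rewrite memv_cap => /andP[xU].
by rewrite memv_ker qid // memv0.
Qed.

End Separable.

(** * Irreducible characters *)

Section Characters.
Variables (F : numClosedFieldType) (A : falgType F) (e : separability A).
Implicit Types M N : lmodule A.

Lemma simple_dim_gt0 M : simple_module M -> (0 < \dim {:M})%N.
Proof. by case=> n0 _; rewrite lt0n dimv_eq0. Qed.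

(** [f] has an eigenvalue c; were f - c nonzero, Schur's lemma would make it injective, leaving no
    eigenvector for c. *)
Lemma Schur_scalar M (f : 'End(M)) : simple_module M -> intertwiner f ->
  exists c, f = c *: \1%VF.
Proof.
move=> sM fi.
have [c ev] := eigenvalue_closed (passmx.mxof (vbasis {:M}) (vbasis {:M}) f)
  (simple_dim_gt0 sM).
exists c; apply/eqP; rewrite -subr_eq0; apply/negPn/negP => n0.
have gi : intertwiner (f - c *: \1%VF).
  move=> a x; rewrite !(add_lfunE, opp_lfunE, scale_lfunE, id_lfunE) fi.
  by rewrite [RHS]linearB /= [in RHS]linearZ.
have := passmx.leigenspaceE (vbasisP {:M}) f c.
rewrite /passmx.leigenspace (Schur_inj sM gi n0) => /esym/eqP.
by rewrite passmx.vsof_eq0 ?vbasisP // => E; move: ev; rewrite /eigenvalue E.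
Qed.

Lemma hdim_simple M : simple_module M -> hdim e M M = 1%N.
Proof.
move=> sM; rewrite /hdim.
have -> : limg (avg e M M) = <[\1%VF]>%VS.
  apply/vspaceP => f; apply/mem_limg_avg/vlineP;
    first by move/(Schur_scalar sM).
  by case=> c -> a x; rewrite !scale_lfunE !id_lfunE linearZ.
rewrite dim_vline; apply/eqP; rewrite eqb1; case: sM => + _.
apply: contraNN => /eqP E; rewrite -subv0; apply/subvP => x _.
by rewrite memv0 -[x]id_lfunE E zero_lfunE.
Qed.

Lemma ip_Irr (f g : dual A) : Irr A f -> Irr A g -> ip e f g = (f == g)%:R.
Proof.
move=> [M [sM <-]] [N [sN <-]].
case: eqP => [<-|fg]; first by rewrite ip_character hdim_simple.
rewrite ip_character; have [->//|/hdim_gt0P[h hi h0]] := posnP (hdim e N M).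
by case: fg; rewrite (Schur_character sN sM hi h0).
Qed.

Lemma free_Irr (s : seq (dual A)) : uniq s -> (forall f, f \in s -> Irr A f) ->
  free s.
Proof.
move=> us sI; apply/(@freeP _ _ _ (in_tuple s)) => k k0 i.
have sIn (j : 'I_(size s)) : Irr A s`_j by apply: sI; rewrite mem_nth.
have : ip e (\sum_j k j *: s`_j) s`_i = 0.
  rewrite k0 -[0](scale0r (0 : dual A)) -[0 *: 0]addr0.
  by rewrite ip_is_linearl /ip scale0r add0r big1 // => p _;
    rewrite zero_lfunE mul0r.
rewrite ip_suml (bigD1 i) //= ip_Irr // eqxx mulr1 big1 ?addr0 // => j ji.
by rewrite ip_Irr // nth_uniq // (negPf ji : (j == i :> nat) = false) mulr0.
Qed.

Definition irr_enum n (irr : 'I_n -> dual A) : Prop :=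
  injective irr /\ (forall f, Irr A f <-> exists i, irr i = f).

(** Orthonormality makes distinct irreducible characters free, so their number is bounded by the
    dimension of the dual; a longest list contains them all. *)
Lemma irr_enum_exists : exists n (irr : 'I_n -> dual A), irr_enum irr.
Proof.
pose P n := `[< exists s : seq (dual A),
  [/\ uniq s, size s = n & forall f, f \in s -> Irr A f] >].
have exP : exists n, P n by exists 0%N; apply/asboolP; exists [::].
have bP n : P n -> (n <= \dim {:dual A})%N.
  move=> /asboolP[s [us <- /(free_Irr us)]]; rewrite /free => /eqP <-.
  by rewrite dimvS ?subvf.
have [n /asboolP[s [us sn sI]] nmax] := ex_maxnP exP bP.
exists (size s), (fun i => tnth (in_tuple s) i); split.
  by apply/injectiveP; rewrite -[injectiveb _]/(uniq (map _ _)) map_tnth_enum.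
move=> f; split=> [fI|[i <-]]; last by apply: sI; rewrite mem_tnth.
suff: f \in s by move=> /(@tnthP _ _ (in_tuple s))[i ->]; exists i.
apply/negPn/negP => fs.
have /nmax : P (size s).+1.
  apply/asboolP; exists (f :: s); split=> //=; first by rewrite fs.
  by move=> g; rewrite inE => /orP[/eqP->|/sI].
by rewrite -sn ltnn.
Qed.

Section Enum.
Variables (n : nat) (irr : 'I_n -> dual A).
Hypothesis irrP : irr_enum irr.

Lemma irr_Irr i : Irr A (irr i).
Proof. by apply/irrP.2; exists i. Qed.

Lemma ip_irr i j : ip e (irr i) (irr j) = (i == j)%:R.
Proof. by rewrite ip_Irr ?(inj_eq irrP.1) //; exact: irr_Irr. Qed.

Lemma character_decomp M : exists m : 'I_n -> nat,
  character M = \sum_i (m i)%:R *: irr i.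
Proof.
have [k] := ubnP (\dim {:M}); elim: k M => // k IH M; rewrite ltnS => dM.
have [sM|nsM] := pselect (simple_module M).
  have /irrP.2[i0 i0M] : Irr A (character M) by exists M.
  exists (fun i => (i == i0) : nat); rewrite (bigD1 i0) //= eqxx scale1r i0M.
  by rewrite big1 ?addr0 // => i /negPf ->; rewrite scale0r.
have [z|nz] := eqVneq (fullv : {vspace M}) 0%VS.
  exists (fun=> 0%N); rewrite big1 => [|i _]; last by rewrite scale0r.
  apply/lfunP => a; rewrite characterE zero_lfunE.
  have -> : act M a = 0.
    by apply/lfunP => x; apply/eqP; rewrite zero_lfunE -memv0 -z memvf.
  exact: linear0.
have [U [sU U0 U1]] : exists U, [/\ @submodule _ _ M U, U != 0%VS & U != fullv].
  apply: contrapT => nU; apply: nsM; split=> // U sU.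
  have [?|U0] := eqVneq U 0%VS; [by left|right; apply/eqP/negPn/negP => U1].
  by apply: nU; exists U.
have [W [sW UW UW0]] := submodule_compl e sU.
have dUW : (\dim U + \dim W)%N = \dim {:M} by rewrite -UW dimv_disjoint_sum.
have dU : (0 < \dim U < \dim {:M})%N.
  rewrite lt0n dimv_eq0 U0 /= ltn_neqAle dimvS ?subvf // andbT.
  by apply: contraNN U1 => /eqP d; rewrite eqEdim subvf d leqnn.
have [|m1 E1] := IH (submod sU).
  rewrite dimvf /dim /=; apply: leq_trans dM; by case/andP: dU.
have [|m2 E2] := IH (submod sW).
  rewrite dimvf /dim /=; apply: leq_trans dM; rewrite -dUW.
  by rewrite -[X in (X < _)%N]add0n ltn_add2r; case/andP: dU.
exists (fun i => m1 i + m2 i)%N; rewrite (character_dsum sU sW) // E1 E2.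
by rewrite -big_split; apply: eq_bigr => i _; rewrite natrD scalerDl.
Qed.

Lemma character_sum M : character M = \sum_i ip e (irr i) (character M) *: irr
  i.
Proof.
have [m ->] := character_decomp M; apply: eq_bigr => i _; congr (_ *: _).
rewrite ip_sumr (bigD1 i) //= ip_irr eqxx mulr1 big1 ?addr0 // => j ji.
by rewrite ip_irr eq_sym (negPf ji) mulr0.
Qed.

Lemma ip_irrC M i : ip e (irr i) (character M) = ip e (character M) (irr i).
Proof.
have [m ->] := character_decomp M; rewrite ip_sumr ip_suml.
by apply: eq_bigr => j _; rewrite !ip_irr eq_sym.
Qed.

(** Evaluation at 1 identifies Hom_A(A, M) with M. *)
Lemma ip_regular M : ip e (character M) (character (regular A)) = character M 1.
Proof.
rewrite ip_character character1; congr (_%:R).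
pose ev : 'Hom('Hom(regular A, M), M) := linfun (fun f : 'Hom(regular A, M) =>
  f 1).
have evE f : ev f = f 1.
  by apply: linfunE => c g h; rewrite add_lfunE scale_lfunE.
rewrite /hdim -(@limg_dim_eq _ _ _ ev).
  congr (\dim _); apply/vspaceP => x; rewrite memvf.
  pose f : 'Hom(regular A, M) := linfun (fun a => act M a x).
  have fE a : f a = act M a x.
    by apply: linfunE => c b d; rewrite linearP add_lfunE scale_lfunE.
  rewrite -[x]act1E -fE -evE memv_img //; apply/mem_limg_avg => a b.
  by rewrite !fE /= lfunE /= lfunE /= actME.
apply/eqP; rewrite -subv0; apply/subvP => f; rewrite memv_cap => /andP[].
move=> /mem_limg_avg fi; rewrite memv_ker evE memv0 => /eqP f1.
apply/eqP/lfunP => a; rewrite zero_lfunE -[a]mulr1.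
have -> : a * 1 = act (regular A) a 1 by rewrite /= lfunE /= lfunE.
by rewrite fi f1 linear0.
Qed.

Lemma character_regular :
  character (regular A) = \sum_i irr i 1 *: irr i.
Proof.
rewrite character_sum; apply: eq_bigr => i _.
by have [N [_ <-]] := irr_Irr i; rewrite ip_regular.
Qed.

End Enum.
End Characters.

(** * Sweedler sums *)

Definition trilinear_fun (F : fieldType) (U V W X : vectType F)
    (f : U -> V -> W -> X) :=
  [/\ forall u v, linear (f u v), forall u w, linear (fun v => f u v w)
    & forall v w, linear (fun u => f u v w)].

Lemma linear_funZ (F : fieldType) (V W : vectType F) (f : V -> W) :
  linear f -> forall c u, f (c *: u) = c *: f u.
Proof.
by move=> fl c u; rewrite -(linfunE fl (c *: u)) linearZ /= (linfunE fl).
Qed.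

Lemma linear_fun_sum (F : fieldType) (V W : vectType F) (f : V -> W) :
  linear f -> forall (I : Type) (r : seq I) (u : I -> V),
  f (\sum_(i <- r) u i) = \sum_(i <- r) f (u i).
Proof.
move=> fl I r u; rewrite -(linfunE fl (\sum_(i <- r) u i)) linear_sum /=.
by apply: eq_bigr => i _; rewrite (linfunE fl).
Qed.

(* The comultiplication is presented by lists of pairs, so that Sweedler sums  *)
(* are big sums; this serves both [H] and the Hopf subalgebra [K], whose       *)
(* carrier [subvs_of K] is not declared as a Hopf algebra.                     *)
Record sweedler (F : fieldType) (A : falgType F) := Sweedler {
  cop : A -> seq (A * A);
  eps : 'Hom(A, F^o);
  anti : 'End(A);
  cop_linear (W : vectType F) (f : A -> A -> W) : bilinear_fun f ->
    linear (fun x => \sum_(p <- cop x) f p.1 p.2);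
  cop_coassoc (W : vectType F) (f : A -> A -> A -> W) x : trilinear_fun f ->
    \sum_(p <- cop x) \sum_(q <- cop p.1) f q.1 q.2 p.2 =
    \sum_(p <- cop x) \sum_(q <- cop p.2) f p.1 q.1 q.2;
  cop_counitl x : \sum_(p <- cop x) eps p.1 *: p.2 = x;
  cop_counitr x : \sum_(p <- cop x) eps p.2 *: p.1 = x;
  cop1 (W : vectType F) (f : A -> A -> W) : bilinear_fun f ->
    \sum_(p <- cop 1) f p.1 p.2 = f 1 1;
  copM (W : vectType F) (f : A -> A -> W) x y : bilinear_fun f ->
    \sum_(p <- cop (x * y)) f p.1 p.2 =
    \sum_(p <- cop x) \sum_(q <- cop y) f (p.1 * q.1) (p.2 * q.2);
  eps1 : eps 1 = 1;
  epsM x y : eps (x * y) = eps x * eps y;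
  antil x : \sum_(p <- cop x) anti p.1 * p.2 = eps x *: 1;
  antir x : \sum_(p <- cop x) p.1 * anti p.2 = eps x *: 1
}.

Lemma linear_bigsum (F : fieldType) (V W : vectType F) (I : Type) (r : seq I)
    (f : I -> V -> W) :
  (forall i, linear (f i)) -> linear (fun x => \sum_(i <- r) f i x).
Proof.
move=> fl c u v; rewrite scaler_sumr -big_split /=.
by apply: eq_bigr => i _; rewrite fl.
Qed.

Ltac lin_step :=
  rewrite ?(linearP, mulrDl, mulrDr, comp_lfunDl, comp_lfunDr, add_lfunE,
    scale_lfunE, tens_linearl, tens_linearr, scalerDl, scalerDr) /=;
  rewrite -?(scalerAl, scalerAr, comp_lfunZl, comp_lfunZr).

Ltac lin :=
  let c := fresh "c" in let u := fresh "u" in let v := fresh "v" in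
  move=> c u v; do 4 lin_step;
  first [by rewrite -?scalerA | by rewrite ?scalerA ?[_ * c]mulrC].

Ltac multilin :=
  rewrite ?/bilinear_fun ?/trilinear_fun;
  repeat lazymatch goal with
  | |- GRing.linear_for _ _ => fail
  | |- _ /\ _ => split
  | |- and3 _ _ _ => split
  | |- forall _, _ => intro
  end;
  repeat (apply: linear_bigsum; intro);
  by lin.

Section HopfSweedler.
Variables (F : fieldType) (H : hopfAlgType F).

Definition hopf_cop (x : H) : seq (H * H) :=
  [seq ((comul x : tensor H H) p.1 p.2 *: (vbasis {:H})`_p.1, (vbasis
    {:H})`_p.2)
     | p : 'I_(\dim {:H}) * 'I_(\dim {:H})].

Lemma hopf_copE (W : vectType F) (f : H -> H -> W) x : bilinear_fun f ->
  \sum_(p <- hopf_cop x) f p.1 p.2 = tlift f (comul x).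
Proof.
move=> [fr fl]; rewrite big_image /= lfunE /= /tlift_fun pair_big /=.
apply: eq_bigr => -[i j] _ /=.
by rewrite (linear_funZ (fl _)).
Qed.

Lemma hopf_cop_linear (W : vectType F) (f : H -> H -> W) : bilinear_fun f ->
  linear (fun x => \sum_(p <- hopf_cop x) f p.1 p.2).
Proof. by move=> fb c x y; rewrite !hopf_copE // linearP linearP. Qed.

Lemma hopf_cop_tens x : \sum_(p <- hopf_cop x) p.1 ⊗ p.2 = comul x.
Proof.
have tb : bilinear_fun (fun a b : H => a ⊗ b).
  by split=> u c y z; rewrite ?tens_linearl ?tens_linearr.
rewrite (hopf_copE x tb);
  have {2}-> : comul x = \1%VF (comul x) by rewrite id_lfunE.
congr (fun_of_lfun _ _); apply: tensor_hom_ext => u v.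
by rewrite tlift_tens ?id_lfunE //; apply tb.
Qed.

Lemma tlift_linear (Y U V W : vectType F) (f : Y -> U -> V -> W) t :
  (forall y, bilinear_fun (f y)) -> (forall u v, linear (fun y => f y u v)) ->
  linear (fun y => tlift (f y) t).
Proof.
move=> fb fl c y z; rewrite -scale_lfunE -add_lfunE.
congr (fun_of_lfun _ _); apply: tensor_hom_ext => u v.
rewrite add_lfunE scale_lfunE !tlift_tens; first exact: fl.
all: by apply fb.
Qed.

Lemma tlift_trilin (U V W X : vectType F) (f : U -> V -> W -> X) u v w :
  trilinear_fun f -> tlift (fun a => tlift (f a)) (u ⊗ (v ⊗ w)) = f u v w.
Proof.
move=> [f3 f2 f1]; rewrite tlift_tens; first by rewrite tlift_tens.
  by move=> x; exact: linearP.
by move=> t; apply: (tlift_linear (f := f)).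
Qed.

Lemma hopf_coassoc (W : vectType F) (f : H -> H -> H -> W) x : trilinear_fun f
  ->
  \sum_(p <- hopf_cop x) \sum_(q <- hopf_cop p.1) f q.1 q.2 p.2 =
  \sum_(p <- hopf_cop x) \sum_(q <- hopf_cop p.2) f p.1 q.1 q.2.
Proof.
move=> ft; have [f3 f2 f1] := ft.
pose T := tlift (fun a => tlift (f a)).
have := congr1 (fun g => T (fun_of_lfun g x)) (comulA (s := H)).
rewrite !comp_lfunE -hopf_cop_tens !linear_sum /= => E.
transitivity (\sum_(i <- hopf_cop x) T (tassoc H H H (tmap comul \1%VF (i.1 ⊗
  i.2)))).
  apply: eq_bigr => p _; rewrite tmapE id_lfunE -hopf_cop_tens.
  rewrite (linear_fun_sum (@tens_linearl _ _ _ _)) !linear_sum.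
  apply: eq_bigr => q _; rewrite /tassoc /= tlift_tens /=.
  - by rewrite tlift_tens ?tlift_trilin // => y; multilin.
  - move=> t; apply: (tlift_linear (f := fun w u v => u ⊗ (v ⊗ w))) => *;
    multilin.
  by move=> y; exact: linearP.
rewrite E; apply: eq_bigr => p _; rewrite tmapE id_lfunE -hopf_cop_tens.
rewrite (linear_fun_sum (@tens_linearr _ _ _ _)) !linear_sum.
by apply: eq_bigr => q _; exact: tlift_trilin.
Qed.

Lemma tmul_tensl (a b : H) t :
  tmul (a ⊗ b) t = tlift (fun c d : H => (a * c) ⊗ (b * d)) t.
Proof.
rewrite /tmul tlift_tens // => x.
  apply: (tlift_linear (Y := H) (U := H) (V := H) (f := fun (b c d : H) => (x *
    c) ⊗ (b * d))) => *; multilin.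
apply: (tlift_linear (Y := H) (U := H) (V := H) (f := fun (a c d : H) => (a *
  c) ⊗ (x * d))) => *; multilin.
Qed.

Lemma tmul_linearl (t : tensor H H) : linear (fun s => tmul s t).
Proof. by move=> c u v; rewrite /tmul linearP. Qed.

Lemma tmul_linearr (a b : H) : linear (tmul (a ⊗ b)).
Proof. by move=> c u v; rewrite !tmul_tensl linearP. Qed.

Lemma tmul_tens (a b c d : H) : tmul (a ⊗ b) (c ⊗ d) = (a * c) ⊗ (b * d).
Proof. rewrite tmul_tensl tlift_tens // => *; multilin. Qed.

(** Kept transparent so that its [cop] converts to [hopf_cop], as in [hopf_cop_tlift]. *)
Definition hopf_sweedler : sweedler H.
Proof.
apply: (@Sweedler _ _ hopf_cop counit antipode).
- exact: hopf_cop_linear.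
- exact: hopf_coassoc.
- move=> x; rewrite (hopf_copE (W := H) _ (f := fun a b : H => (counit a : F)
  *: b)); last by multilin.
  by rewrite -comp_lfunE counitl id_lfunE.
- move=> x; rewrite (hopf_copE (W := H) _ (f := fun a b : H => (counit b : F)
  *: a)); last by multilin.
  by rewrite -comp_lfunE counitr id_lfunE.
- by move=> W f [fr fl]; rewrite hopf_copE // comul1 tlift_tens.
- move=> W f x y [fr fl]; rewrite hopf_copE // comulM.
  rewrite -!hopf_cop_tens.
  rewrite (linear_fun_sum (tmul_linearl _) (hopf_cop x)) linear_sum.
  apply: eq_bigr => p _ /=.
  rewrite (linear_fun_sum (tmul_linearr _ _) (hopf_cop y)) linear_sum.
  by apply: eq_bigr => q _ /=; rewrite tmul_tens tlift_tens.
- exact: counit1.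
- exact: counitM.
- move=> x; rewrite (hopf_copE (W := H) _ (f := fun a b => antipode a * b));
  last by multilin.
  exact: antipodel.
- move=> x; rewrite (hopf_copE (W := H) _ (f := fun a b => a * antipode b));
  last by multilin.
  exact: antipoder.
Defined.

End HopfSweedler.

Section SubHopf.
Variables (F : fieldType) (H : hopfAlgType F) (K : {aspace H}).
Hypothesis hK : hopf_subalgebra K.

Local Notation sw := (hopf_sweedler H).

Lemma span_pure_tensors (U V : vectType F) (A : {vspace U}) (B : {vspace V})
    (X : seq (tensor U V)) t :
  (forall x, x \in X -> exists a b, [/\ a \in A, b \in B & x = a ⊗ b]) ->
  t \in <<X>>%VS ->
  exists s : seq (U * V), (forall p, p \in s -> (p.1 \in A) /\ (p.2 \in B)) /\
    t = \sum_(p <- s) p.1 ⊗ p.2.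
Proof.
elim: X t => [|x X IH] t pX.
  by rewrite span_nil memv0 => /eqP ->; exists [::]; rewrite big_nil.
rewrite span_cons => /memv_addP[_ /vlineP[c ->] [u uX ->]].
have [a [b [aA bB ->]]] := pX x (mem_head _ _).
have [y yX|s [sP ->]] := IH u _ uX; first by apply: pX; rewrite inE yX orbT.
exists ((c *: a, b) :: s); split=> [p|].
  by rewrite inE => /orP[/eqP -> /=|/sP//]; rewrite rpredZ.
by rewrite big_cons /= (linear_funZ (@tens_linearl _ _ _ b)).
Qed.

Lemma sub_cop_exists (k : subvs_of K) : exists s : seq (subvs_of K * subvs_of
  K),
  comul (vsval k) = \sum_(p <- s) vsval p.1 ⊗ vsval p.2.
Proof.
have [_ /subvP DK _] := hK.
have := DK _ (memv_img comul (subvsP k)).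
have pX : forall x, x \in [seq a ⊗ b | a <- vbasis K, b <- vbasis K] ->
    exists a b : H, [/\ a \in K, b \in K & x = a ⊗ b].
  by move=> _ /allpairsP[[a b] /= [/vbasis_mem aK /vbasis_mem bK ->]];
    exists a, b.
move=> /(span_pure_tensors pX)[s [sP ->]].
exists [seq (vsproj K p.1, vsproj K p.2) | p <- s]; rewrite big_map.
rewrite big_seq [RHS]big_seq; apply: eq_bigr => p /sP[p1 p2].
by rewrite !vsprojK.
Qed.

(** The lists chosen for different elements are unrelated; only sums of bilinear functions over them
    matter, and [sub_cop_val] and [sub_cop_proj] compute these inside [H]. *)
Definition sub_cop k := sval (cid (sub_cop_exists k)).

Lemma hopf_cop_tlift (W : vectType F) (f : H -> H -> W) x : bilinear_fun f ->
  \sum_(p <- cop sw x) f p.1 p.2 = tlift f (comul x).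
Proof. exact: hopf_copE. Qed.

Lemma sub_cop_val (W : vectType F) (f : H -> H -> W) k : bilinear_fun f ->
  \sum_(p <- sub_cop k) f (vsval p.1) (vsval p.2) =
  \sum_(p <- cop sw (vsval k)) f p.1 p.2.
Proof.
move=> fb; rewrite hopf_cop_tlift // (svalP (cid (sub_cop_exists k)))
  linear_sum.
by apply: eq_bigr => p _ /=; rewrite tlift_tens //; apply fb.
Qed.

Lemma sub_cop_proj (W : vectType F) (f : subvs_of K -> subvs_of K -> W) k :
  bilinear_fun f ->
  \sum_(p <- sub_cop k) f p.1 p.2 =
  \sum_(p <- cop sw (vsval k)) f (vsproj K p.1) (vsproj K p.2).
Proof.
move=> [fr fl]; rewrite -(sub_cop_val (f := fun a b => f (vsproj K a) (vsproj K
  b))).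
  by apply: eq_bigr => p _; rewrite !vsvalK.
by split=> u c v w; rewrite linearP ?fr ?fl.
Qed.

Lemma sub_val1 : vsval (1 : subvs_of K) = 1.
Proof. by apply/eqP; rewrite -[vsval 1]/(algid K) algid_eq1; case: hK. Qed.

Lemma sub_valM (x y : subvs_of K) : vsval (x * y) = vsval x * vsval y.
Proof. by []. Qed.

Lemma sub_valZ c (x : subvs_of K) : vsval (c *: x) = c *: vsval x.
Proof. by []. Qed.

Definition sub_eps : 'Hom(subvs_of K, F^o) := (eps sw \o linfun vsval)%VF.

Definition sub_anti : 'End(subvs_of K) :=
  (linfun (vsproj K) \o anti sw \o linfun vsval)%VF.

Lemma sub_epsE k : sub_eps k = eps sw (vsval k).
Proof. by rewrite comp_lfunE lfunE. Qed.

Lemma sub_antiE k : vsval (sub_anti k) = anti sw (vsval k).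
Proof.
rewrite !comp_lfunE !lfunE /= vsprojK //.
by have [_ _ /subvP SK] := hK; apply: SK; rewrite memv_img // subvsP.
Qed.

Definition sub_sweedler : sweedler (subvs_of K).
Proof.
apply: (@Sweedler _ _ sub_cop sub_eps sub_anti).
- move=> W f fb; have [fr fl] := fb; move=> c x y;
  rewrite !sub_cop_proj // linearP.
  apply: (cop_linear sw (f := fun a b => f (vsproj K a) (vsproj K b))).
  by split=> u d v w; rewrite linearP ?fr ?fl.
- move=> W f x [f3 f2 f1].
  pose g a b c := f (vsproj K a) (vsproj K b) (vsproj K c).
  have gt : trilinear_fun g.
    by split=> u v c w z; rewrite /g linearP ?f1 ?f2 ?f3.
  have gE a b c : f a b c = g (vsval a) (vsval b) (vsval c) by rewrite /g
    !vsvalK.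
  have [g3 g2 g1] := gt.
  transitivity (\sum_(p <- sub_cop x) \sum_(q <- cop sw (vsval p.1)) g q.1 q.2
    (vsval p.2)).
    apply: eq_bigr => p _;
      rewrite -(sub_cop_val (f := fun a b => g a b (vsval p.2))) //.
    by apply: eq_bigr => q _; rewrite gE.
  transitivity (\sum_(p <- sub_cop x) \sum_(q <- cop sw (vsval p.2)) g (vsval
    p.1) q.1 q.2); last first.
    apply: eq_bigr => p _;
      rewrite -(sub_cop_val (f := fun a b => g (vsval p.1) a b)) //.
    by apply: eq_bigr => q _; rewrite gE.
  rewrite (sub_cop_val (f := fun a b => \sum_(q <- cop sw a) g q.1 q.2 b));
    last first.
    split=> u; first by apply: linear_bigsum => q.
    by apply: (cop_linear sw (f := fun a b => g a b u)); split.
  rewrite (sub_cop_val (f := fun a b => \sum_(q <- cop sw b) g a q.1 q.2));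
    last first.
    split=> u; last by apply: linear_bigsum => q.
    by apply: (cop_linear sw (f := g u)); split.
  exact: cop_coassoc.
- move=> x; apply: subvs_inj; rewrite linear_sum /= -[RHS](cop_counitl sw).
  rewrite -(sub_cop_val (f := fun a b => (eps sw a : F) *: b));
    last by multilin.
  by apply: eq_bigr => p _; rewrite /= sub_epsE.
- move=> x; apply: subvs_inj; rewrite linear_sum /= -[RHS](cop_counitr sw).
  rewrite -(sub_cop_val (f := fun a b => (eps sw b : F) *: a));
    last by multilin.
  by apply: eq_bigr => p _; rewrite /= sub_epsE.
- move=> W f [fr fl]; rewrite sub_cop_proj // sub_val1.
  rewrite (cop1 sw (f := fun a b => f (vsproj K a) (vsproj K b))).
    by rewrite -sub_val1 vsvalK.
  by split=> u c v w; rewrite linearP ?fr ?fl.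
- move=> W f x y [fr fl].
  pose g a b := f (vsproj K a) (vsproj K b).
  have gb : bilinear_fun g by split=> u c v w; rewrite /g linearP ?fr ?fl.
  have [gr gl] := gb.
  rewrite sub_cop_proj // sub_valM -/(g _ _) (copM sw _ _ gb).
  rewrite -(sub_cop_val (f := fun a b => \sum_(q <- cop sw (vsval y)) g (a *
    q.1) (b * q.2))).
    apply: eq_bigr => p _.
    rewrite -(sub_cop_val (f := fun a b => g (vsval p.1 * a) (vsval p.2 * b))).
      by apply: eq_bigr => q _; rewrite -!sub_valM /g !vsvalK.
    by split=> u c v w; rewrite mulrDr -scalerAr ?gr ?gl.
  by split=> u; apply: linear_bigsum => q c v w;
    rewrite mulrDl -scalerAl ?gr ?gl.
- by rewrite sub_epsE sub_val1 eps1.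
- by move=> x y; rewrite !sub_epsE sub_valM epsM.
- move=> x; apply: subvs_inj;
  rewrite linear_sum [RHS]sub_valZ sub_epsE sub_val1 -antil.
  rewrite -(sub_cop_val (f := fun a b => anti sw a * b)); last by multilin.
  by apply: eq_bigr => p _; rewrite -sub_antiE.
- move=> x; apply: subvs_inj;
  rewrite linear_sum [RHS]sub_valZ sub_epsE sub_val1 -antir.
  rewrite -(sub_cop_val (f := fun a b => a * anti sw b)); last by multilin.
  by apply: eq_bigr => p _; rewrite -sub_antiE.
Defined.

End SubHopf.

Section Sweedler.
Variables (F : fieldType) (A : falgType F) (sw : sweedler A).
Local Notation cop := (cop sw).
Local Notation eps := (eps sw).
Local Notation S := (anti sw).

Lemma counitlE (W : vectType F) (h : A -> W) x : linear h ->
  \sum_(p <- cop x) (eps p.1 : F) *: h p.2 = h x.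
Proof.
move=> hl; rewrite -[in RHS](cop_counitl sw x) (linear_fun_sum hl).
by apply: eq_bigr => p _; rewrite (linear_funZ hl).
Qed.

Lemma counitrE (W : vectType F) (h : A -> W) x : linear h ->
  \sum_(p <- cop x) (eps p.2 : F) *: h p.1 = h x.
Proof.
move=> hl; rewrite -[in RHS](cop_counitr sw x) (linear_fun_sum hl).
by apply: eq_bigr => p _; rewrite (linear_funZ hl).
Qed.

Lemma antilE (W : vectType F) (h : A -> W) x : linear h ->
  \sum_(p <- cop x) h (S p.1 * p.2) = (eps x : F) *: h 1.
Proof. by move=> hl; rewrite -(linear_fun_sum hl) antil (linear_funZ hl). Qed.

Lemma antirE (W : vectType F) (h : A -> W) x : linear h ->
  \sum_(p <- cop x) h (p.1 * S p.2) = (eps x : F) *: h 1.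
Proof. by move=> hl; rewrite -(linear_fun_sum hl) antir (linear_funZ hl). Qed.

(** S(x_1 y_1) x_2 y_2 S(y_3) S(x_3) is evaluated twice: cancelling from the right leaves S(x y),
    cancelling from the left leaves S(y) S(x). *)
Lemma antiM x y : S (x * y) = S y * S x.
Proof.
pose g a b c := \sum_(r <- cop y) \sum_(s <- cop r.2)
  S (a * r.1) * ((b * s.1) * (S s.2 * S c)).
have gt : trilinear_fun g by rewrite /g; multilin.
transitivity (\sum_(p <- cop x) \sum_(q <- cop p.2) g p.1 q.1 q.2).
  rewrite -(counitrE (h := fun a => S (a * y))); last by multilin.
  apply: eq_bigr => p _; rewrite /g exchange_big /=.
  rewrite -(counitrE (h := fun b => S (p.1 * b)) y); last by multilin.
  rewrite scaler_sumr; apply: eq_bigr => r _.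
  under eq_bigr => q _.
    under eq_bigr => s _ do rewrite -(mulrA q.1) (mulrA s.1).
    rewrite (antirE (h := fun z => S (p.1 * r.1) * (q.1 * (z * S q.2))));
      last by multilin.
    rewrite mul1r; over.
  rewrite -scaler_sumr (antirE (h := fun z => S (p.1 * r.1) * z));
    last by multilin.
  by rewrite mulr1 !scalerA mulrC.
rewrite -cop_coassoc //.
rewrite -(counitlE (h := fun a => S y * S a)); last by multilin.
apply: eq_bigr => p _.
transitivity (\sum_(q <- cop p.1) \sum_(r <- cop y) \sum_(s <- cop r.1)
   S (q.1 * s.1) * ((q.2 * s.2) * (S r.2 * S p.2))).
  apply: eq_bigr => q _.
  rewrite (cop_coassoc sw (f := fun a b c => S (q.1 * a) * ((q.2 * b) * (S c *
    S p.2)))) //.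
  multilin.
rewrite exchange_big /= -(counitlE (h := fun b => S b * S p.2) y);
  last by multilin.
rewrite scaler_sumr; apply: eq_bigr => r _.
rewrite -(copM sw (f := fun a b => S a * (b * (S r.2 * S p.2))));
  last by multilin.
under eq_bigr => q _ do rewrite mulrA.
rewrite (antilE (h := fun z => z * (S r.2 * S p.2))); last by multilin.
by rewrite mul1r epsM scalerA.
Qed.

Section Integral.
Variable t : A.
Hypothesis tI : forall a, a * t = (eps a : F) *: t.
Hypothesis t1 : eps t = 1.

Lemma integral_sep_mul : \sum_(p <- [seq (p.1, S p.2) | p <- cop t]) p.1 * p.2
  = 1.
Proof. by rewrite big_map /= antir t1 scale1r. Qed.

(** The tensor a_1 t_1 ⊗ S(a_2 t_2) a_3 equals a t_1 ⊗ S(t_2) by the antipode axiom, and t_1 ⊗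
    S(t_2) a because a_1 t = eps(a_1) t. *)
Lemma integral_sep_comm (W : vectType F) (f : A -> A -> W) a : bilinear_fun f ->
  \sum_(p <- [seq (p.1, S p.2) | p <- cop t]) f (a * p.1) p.2 =
  \sum_(p <- [seq (p.1, S p.2) | p <- cop t]) f p.1 (p.2 * a).
Proof.
move=> [fr fl]; rewrite !big_map /=.
pose h a b c := \sum_(p <- cop t) f (a * p.1) (S (b * p.2) * c).
have ht : trilinear_fun h.
  by split=> [u v|u w|v w]; apply: linear_bigsum => p c y z;
    rewrite ?(mulrDl, mulrDr, linearP) -?(scalerAl, scalerAr) ?(mulrDl, mulrDr,
      linearP)
      -?(scalerAl, scalerAr) ?fr ?fl.
transitivity (\sum_(u <- cop a) \sum_(v <- cop u.2) h u.1 v.1 v.2).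
  rewrite -(counitrE (h := fun b => \sum_(p <- cop t) f (b * p.1) (S p.2)));
    last first.
    by apply: linear_bigsum => p c y z; rewrite mulrDl -scalerAl fl.
  apply: eq_bigr => u _; rewrite exchange_big scaler_sumr;
    apply: eq_bigr => p _ /=.
  under eq_bigr => v _ do rewrite antiM -mulrA.
  rewrite (antilE (h := fun z => f (u.1 * p.1) (S p.2 * z))) ?mulr1 //.
  by move=> c y z; rewrite mulrDr -scalerAr fr.
rewrite -cop_coassoc //.
rewrite -(counitlE (h := fun b => \sum_(p <- cop t) f p.1 (S p.2 * b)));
  last first.
  by apply: linear_bigsum => p c y z; rewrite mulrDr -scalerAr fr.
apply: eq_bigr => u _.
rewrite -(copM sw (f := fun a b => f a (S b * u.2))); last first.
  by split=> v c y z; rewrite ?fl // linearP mulrDl -scalerAl fr.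
rewrite tI; apply: (linear_funZ (cop_linear sw (f := fun a b => f a (S b *
  u.2)) _)).
by split=> v c y z; rewrite ?fl // linearP mulrDl -scalerAl fr.
Qed.

Definition integral_separability : separability A :=
  Separability integral_sep_mul integral_sep_comm.

End Integral.

Lemma tmap_linearl (U V U' V' : vectType F) (g : 'Hom(V, V')) :
  linear (fun f : 'Hom(U, U') => tmap f g).
Proof.
move=> c f1 f2; apply: tensor_hom_ext => u v.
by rewrite !(add_lfunE, scale_lfunE, tmapE) tens_linearl.
Qed.

Lemma tmap_linearr (U V U' V' : vectType F) (f : 'Hom(U, U')) :
  linear (fun g : 'Hom(V, V') => tmap f g).
Proof.
move=> c f1 f2; apply: tensor_hom_ext => u v.
by rewrite !(add_lfunE, scale_lfunE, tmapE) tens_linearr.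
Qed.

(** * Tensor products of modules *)

Section TensorModule.
Variables M N : lmodule A.

Definition tens_act_fun (a : A) : 'End(tensor M N) :=
  \sum_(p <- cop a) tmap (act M p.1) (act N p.2).

Lemma tens_act_bilinear : bilinear_fun (fun a b => tmap (act M a) (act N b)).
Proof. by split=> u c x y; rewrite linearP ?tmap_linearl ?tmap_linearr. Qed.

Fact tens_act_is_linear : linear tens_act_fun.
Proof. exact: (cop_linear sw tens_act_bilinear). Qed.

Fact tens_act1 : linfun tens_act_fun 1 = \1%VF.
Proof.
rewrite (linfunE tens_act_is_linear) /tens_act_fun (cop1 sw tens_act_bilinear).
by apply: tensor_hom_ext => u v; rewrite tmapE !act1E id_lfunE.
Qed.

Fact tens_actM x y : linfun tens_act_fun (x * y) =
  (linfun tens_act_fun x \o linfun tens_act_fun y)%VF.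
Proof.
rewrite !(linfunE tens_act_is_linear) /tens_act_fun (copM sw _ _
  tens_act_bilinear).
apply: tensor_hom_ext => u v; rewrite comp_lfunE !sum_lfunE.
apply: eq_bigr => p _; rewrite !sum_lfunE linear_sum; apply: eq_bigr => q _ /=.
by rewrite !tmapE !actME.
Qed.

Definition tensm : lmodule A := LModule tens_act1 tens_actM.

Lemma tensm_actE a (u : M) (v : N) :
  act tensm a (u ⊗ v) = \sum_(p <- cop a) act M p.1 u ⊗ act N p.2 v.
Proof.
rewrite /tensm /= (linfunE tens_act_is_linear) sum_lfunE.
by apply: eq_bigr => p _; rewrite tmapE.
Qed.

Lemma character_tensm a :
  character tensm a = \sum_(p <- cop a) character M p.1 * character N p.2.
Proof.
rewrite characterE /tensm /= (linfunE tens_act_is_linear) linear_sum.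
by apply: eq_bigr => p _; rewrite /= lfun_trace_tmap !characterE.
Qed.

End TensorModule.

End Sweedler.

(** * Regular modules and the existence of integrals *)

Section SweedlerModules.
Variables (F : fieldType) (A : falgType F) (sw : sweedler A).
Local Notation cop := (cop sw).
Local Notation eps := (eps sw).
Local Notation S := (anti sw).

Lemma regularE a b : act (regular A) a b = a * b.
Proof. by rewrite /= lfunE /= lfunE. Qed.

Section RegularTensor.
Variable M : lmodule A.

(* Mutually inverse maps between [A (x) M] with the action on the left factor  *)
(* and [A (x) M] with the diagonal action.                                     *)
Definition untwist_fun (a : A) (m : M) : tensor A M :=
  \sum_(p <- cop a) p.1 ⊗ act M p.2 m.
Definition twist_fun (a : A) (m : M) : tensor A M :=
  \sum_(p <- cop a) p.1 ⊗ act M (S p.2) m.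

Lemma untwist_bilin : bilinear_fun untwist_fun.
Proof.
split=> u; first by apply: linear_bigsum => p; multilin.
apply: (cop_linear sw (f := fun a b => a ⊗ act M b u)); multilin.
Qed.

Lemma twist_bilin : bilinear_fun twist_fun.
Proof.
split=> u; first by apply: linear_bigsum => p; multilin.
apply: (cop_linear sw (f := fun a b => a ⊗ act M (S b) u)); multilin.
Qed.

(** Untwisting conjugates the diagonal action to the action on the left factor alone, so the product
    is dim M copies of the regular module. *)
Lemma character_regular_tens a :
  character (tensm sw (regular A) M) a =
  character M 1 * character (regular A) a.
Proof.
pose T : 'End(tensor A M) := tlift untwist_fun.
pose T' : 'End(tensor A M) := tlift twist_fun.
have [ur ul] := untwist_bilin; have [tr tl] := twist_bilin.
have TE b m : T (b ⊗ m) = untwist_fun b m by rewrite tlift_tens.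
have TE' b m : T' (b ⊗ m) = twist_fun b m by rewrite tlift_tens.
have TT' : (T \o T')%VF = \1%VF.
  apply: tensor_hom_ext => b m; rewrite comp_lfunE id_lfunE TE' linear_sum /=.
  under eq_bigr => p _ do rewrite TE /untwist_fun.
  rewrite (cop_coassoc sw (f := fun a b c => a ⊗ act M b (act M (S c) m)));
    last by multilin.
  rewrite -(counitrE sw (h := fun a => a ⊗ m)); last by multilin.
  apply: eq_bigr => p _; under eq_bigr => q _ do rewrite -actME.
  rewrite (antirE sw (h := fun z => p.1 ⊗ act M z m)); last by multilin.
  by rewrite act1E.
have TT : (T' \o T)%VF = \1%VF.
  apply: tensor_hom_ext => b m; rewrite comp_lfunE id_lfunE TE linear_sum /=.
  under eq_bigr => p _ do rewrite TE' /twist_fun.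
  rewrite (cop_coassoc sw (f := fun a b c => a ⊗ act M (S b) (act M c m)));
    last by multilin.
  rewrite -(counitrE sw (h := fun a => a ⊗ m)); last by multilin.
  apply: eq_bigr => p _; under eq_bigr => q _ do rewrite -actME.
  rewrite (antilE sw (h := fun z => p.1 ⊗ act M z m)); last by multilin.
  by rewrite act1E.
pose D := tmap (act (regular A) a) (\1%VF : 'End(M)).
have DT : (act (tensm sw (regular A) M) a \o T)%VF = (T \o D)%VF.
  apply: tensor_hom_ext => b m; rewrite !comp_lfunE tmapE id_lfunE regularE !TE.
  rewrite /untwist_fun linear_sum (copM sw (f := fun a b => a ⊗ act M b m));
    last by multilin.
  rewrite exchange_big; apply: eq_bigr => p _; rewrite [LHS]tensm_actE.
  by apply: eq_bigr => q _; rewrite regularE actME.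
rewrite characterE -[act _ a]comp_lfun1r -TT' comp_lfunA DT lfun_traceC.
by rewrite comp_lfunA TT comp_lfun1l lfun_trace_tmap lfun_trace_id character1
  mulrC characterE.
Qed.

End RegularTensor.

Lemma anti1 : S 1 = 1.
Proof.
have := antil sw 1; rewrite (cop1 sw (f := fun a b => S a * b));
  last by multilin.
by rewrite mulr1 eps1 scale1r.
Qed.

(* [f (trace_integral v)] is the trace of [x |-> f (x_1) S^2 (x_2) v].         *)
Definition trace_integral (v : A) : A :=
  \sum_(i < \dim {:A}) \sum_(p <- cop (vbasis {:A})`_i)
    coord (vbasis {:A}) i (S (S p.2) * v) *: p.1.

(** Let T_f be the operator whose trace is f([trace_integral v]). Replacing f by f(a -) replaces T_f
    by L_{S(a_2)} T_f L_{a_1}: here S(a_3) S^2(a_2) = S(S(a_2) a_3) collapses, which is why the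
    square of S appears. Cyclicity of the trace and a_1 S(a_2) = eps(a) finish. *)
Lemma trace_integralP v a : a * trace_integral v = (eps a : F) *:
  trace_integral v.
Proof.
pose T (f : 'Hom(A, F^o)) : 'End(A) :=
  linfun (fun x => \sum_(p <- cop x) (f p.1 : F) *: (S (S p.2) * v)).
have Tl (f : 'Hom(A, F^o)) : linear (fun x => \sum_(p <- cop x) (f p.1 : F) *:
  (S (S p.2) * v)).
  apply: (cop_linear sw (f := fun a b => (f a : F) *: (S (S b) * v))); multilin.
have TE f x : T f x = \sum_(p <- cop x) (f p.1 : F) *: (S (S p.2) * v).
  exact: (linfunE (Tl f)).
have trT (f : 'Hom(A, F^o)) : f (trace_integral v) = lfun_trace (T f).
  rewrite /trace_integral /lfun_trace linear_sum; apply: eq_bigr => i _ /=.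
  rewrite TE !linear_sum; apply: eq_bigr => p _.
  by rewrite !linearZ /= mulrC.
pose L b : 'End(A) := linfun (fun x => b * x).
have LE b x : L b x = b * x by apply: linfunE => c y z;
  rewrite mulrDr -scalerAr.
have key (f : 'Hom(A, F^o)) : f (a * trace_integral v) = eps a * f
  (trace_integral v).
  pose fa : 'Hom(A, F^o) := (f \o L a)%VF.
  have -> : f (a * trace_integral v) = fa (trace_integral v) by rewrite
    comp_lfunE LE.
  rewrite !trT.
  have -> : T fa = \sum_(k <- cop a) (L (S k.2) \o (T f \o L k.1))%VF.
    apply/lfunP => x; rewrite TE sum_lfunE.
    under [RHS]eq_bigr => k _ do rewrite !comp_lfunE !LE TE.
    transitivity (\sum_(k <- cop a) \sum_(p <- cop x) \sum_(q <- cop k.1)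
       (f (q.1 * p.1) : F) *: (S k.2 * (S (S (q.2 * p.2)) * v))); last first.
      apply: eq_bigr => k _; rewrite exchange_big /= -(copM sw (f := fun b c =>
        (f b : F) *: (S k.2 * (S (S c) * v)))); last by multilin.
      by rewrite mulr_sumr; apply: eq_bigr => q _; rewrite scalerAr.
    rewrite exchange_big /=; apply: eq_bigr => p _; rewrite comp_lfunE LE.
    rewrite (cop_coassoc sw (f := fun b c d =>
       (f (b * p.1) : F) *: (S d * (S (S (c * p.2)) * v)))); last by multilin.
    rewrite -(counitrE sw (h := fun b => (f (b * p.1) : F) *: (S (S p.2) *
      v))); last by multilin.
    apply: eq_bigr => k _.
    have sE (q : A * A) : S q.2 * (S (S (q.1 * p.2)) * v) = S (S q.1 * q.2) *
      (S (S p.2) * v).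
      by rewrite !antiM !mulrA.
    under eq_bigr => q _ do rewrite sE.
    rewrite (antilE sw (h := fun z => (f (k.1 * p.1) : F) *: (S z * (S (S p.2)
      * v)))); last by multilin.
    by rewrite anti1 mul1r.
  rewrite linear_sum /=.
  under eq_bigr => k _.
    rewrite lfun_traceC -comp_lfunA.
    have -> : (L k.1 \o L (S k.2))%VF = L (k.1 * S k.2).
      by apply/lfunP => x; rewrite comp_lfunE !LE mulrA.
    over.
  rewrite (antirE sw (h := fun z => lfun_trace (T f \o L z)%VF)).
    congr (_ * lfun_trace _); apply/lfunP => x.
    by rewrite comp_lfunE LE mul1r.
  move=> c y z; have -> : L (c *: y + z) = c *: L y + L z.
    apply/lfunP => x; rewrite add_lfunE scale_lfunE !LE mulrDl.
    by rewrite -scalerAl.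
  by rewrite comp_lfunDr -comp_lfunZr linearP.
rewrite [LHS](coord_vbasis (memvf _)) [in RHS](coord_vbasis (memvf
  (trace_integral v))).
rewrite scaler_sumr; apply: eq_bigr => i _; rewrite scalerA; congr (_ *: _).
by have := key (linfun (coord (vbasis {:A}) i : A -> F^o)); rewrite !lfunE.
Qed.

(** With basis b_j, coordinates c_j and z_j = [trace_integral] b_j, the sum over j of eps((z_j)_1)
    c_j(S((z_j)_2)) is 1, so not every z_j vanishes. Expanding z_j, the sum collapses by S^2(x_3)
    S(x_2) = S(x_2 S(x_3)) to sum_i c_i(1) eps(b_i) = eps(1). *)
Lemma trace_integral_neq0 : exists v, trace_integral v != 0.
Proof.
apply: contrapT => n0.
have z v : trace_integral v = 0 by apply/eqP/negPn/negP => nz; apply: n0;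
  exists v.
pose cd i : 'Hom(A, F^o) := linfun (coord (vbasis {:A}) i : A -> F^o).
pose b i := (vbasis {:A})`_i.
have trE v : trace_integral v = \sum_(i < \dim {:A}) \sum_(p <- cop (b i))
    (cd i (S (S p.2) * v) : F) *: p.1.
  by apply: eq_bigr => i _; apply: eq_bigr => p _; rewrite lfunE.
have cdE x : x = \sum_(i < \dim {:A}) (cd i x : F) *: b i.
  by rewrite {1}(coord_vbasis (memvf x)); apply: eq_bigr => i _; rewrite lfunE.
pose e := \sum_(i < \dim {:A}) \sum_(p <- cop (b i)) \sum_(q <- cop p.1)
  (eps q.1 * cd i (S (S p.2) * S q.2) : F^o).
have e1 : e = 1.
  rewrite -(eps1 sw) [in RHS](cdE 1) linear_sum; apply: eq_bigr => i _.
  rewrite (cop_coassoc sw (f := fun x y z => eps x * cd i (S (S z) * S y) :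
    F^o)); last by multilin.
  rewrite linearZ /=.
  transitivity ((cd i 1 : F) *: \sum_(p <- cop (b i)) (eps p.2 : F) *: (eps p.1
    : F^o)).
    rewrite scaler_sumr; apply: eq_bigr => p _.
    under eq_bigr => q _ do rewrite -antiM.
    rewrite (antirE sw (h := fun z => eps p.1 * cd i (S z) : F^o));
      last by multilin.
    rewrite anti1 -[LHS]/(eps p.2 * (eps p.1 * cd i 1)).
    by rewrite -[RHS]/(cd i 1 * (eps p.2 * eps p.1)) mulrA mulrC.
  by rewrite (counitrE sw (h := fun x => eps x : F^o)) // ; multilin.
move: e1; rewrite /e.
suff -> : \sum_(i < \dim {:A}) \sum_(p <- cop (b i)) \sum_(q <- cop p.1)
  (eps q.1 * cd i (S (S p.2) * S q.2) : F^o) = \sum_(j < \dim {:A})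
  \sum_(q <- cop (trace_integral (b j))) (eps q.1 * cd j (S q.2) : F^o).
  rewrite big1 => [/esym/eqP|j _]; first by rewrite oner_eq0.
  rewrite z; have := linear_funZ (cop_linear sw (f := fun x y => eps x * cd j
    (S y) : F^o) _) 0 0.
  by rewrite !scale0r => -> //; multilin.
have hl j : linear (fun x => \sum_(q <- cop x) (eps q.1 * cd j (S q.2) : F^o)).
  by apply: (cop_linear sw (f := fun x y => eps x * cd j (S y) : F^o));
    multilin.
under [RHS]eq_bigr => j _.
  rewrite trE (linear_fun_sum (hl j)).
  under eq_bigr => i _.
    rewrite (linear_fun_sum (hl j)).
    under eq_bigr => p _ do rewrite (linear_funZ (hl j)) scaler_sumr.
    over.
  over.
rewrite [RHS]exchange_big; apply: eq_bigr => i _ /=.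
rewrite [RHS]exchange_big; apply: eq_bigr => p _ /=.
rewrite [RHS]exchange_big; apply: eq_bigr => q _ /=.
rewrite [X in _ * cd i (_ * X)](cdE (S q.2)) mulr_sumr linear_sum mulr_sumr.
apply: eq_bigr => j _; rewrite -scalerAr linearZ /=.
by rewrite -[_ *: _ in RHS]/(_ * _) [RHS]mulrC -mulrA.
Qed.

End SweedlerModules.

(** * Positivity of tensor products with the regular module *)

Section TensorPositivity.
Variables (F : fieldType) (A : falgType F) (sw : sweedler A).
Local Notation cop := (cop sw).
Local Notation eps := (eps sw).
Local Notation S := (anti sw).
Variable t : A.
Hypothesis tI : forall a, a * t = (eps a : F) *: t.
Hypothesis t1 : eps t = 1.
Let e := integral_separability tI t1.

Definition vcoord (V : vectType F) i : 'Hom(V, F^o) :=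
  linfun (coord (vbasis {:V}) i : V -> F^o).

Lemma vcoord_sum (V : vectType F) (x : V) :
  x = \sum_(i < \dim {:V}) (vcoord i x : F) *: (vbasis {:V})`_i.
Proof.
rewrite {1}(coord_vbasis (memvf x)); apply: eq_bigr => i _.
by rewrite [vcoord _ _]lfunE.
Qed.

(* If no intertwiner W -> V (x) A existed, all averages of rank one maps would *)
(* vanish; cancelling the action on V with the antipode then kills W.          *)
Lemma hdim_tens_regular_gt0 (V W : lmodule A) :
  (0 < \dim {:V})%N -> (0 < \dim {:W})%N ->
  (0 < hdim e W (tensm sw V (regular A)))%N.
Proof.
move=> dV dW; rewrite lt0n; apply/negP => /eqP h0.
pose i0 := Ordinal dV; pose v0 : V := (vbasis {:V})`_i0;
  pose c0 : 'Hom(V, F^o) := vcoord i0.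
have c0v0 : c0 v0 = 1.
  by rewrite [LHS]lfunE /= coord_free ?(basis_free (vbasisP _)) // eqxx.
(* This is the average of the rank one map sending w to f(w) (v ⊗ 1). *)
have Z (v : V) (f : 'Hom(W, F^o)) w : \sum_(p <- cop t) \sum_(q <- cop p.1)
    (f (act W (S p.2) w) : F) *: (act V q.1 v ⊗ q.2) = 0.
  have := congr1 (fun g : 'Hom(W, tensm sw V (regular A)) => g w)
    (hdim_eq0 (rank1 f (v ⊗ (1 : A)) : 'Hom(W, tensm sw V (regular A))) h0).
  rewrite zero_lfunE avgxE big_map => E; rewrite -[RHS]E.
  apply: eq_bigr => p _; cbn [fst snd];
    rewrite rank1E lfunZ tensm_actE scaler_sumr.
  by apply: eq_bigr => q _; rewrite regularE mulr1.
(* Applied to the j-th basis vector and summed over j, these maps produce c0(x_1 S(x_2) v0) x_3,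
   which is x since c0(v0) = 1. *)
have psib j : bilinear_fun (fun (v' : V) (x : A) =>
    (c0 v' : F) *: \sum_(s <- cop x) (vcoord j (act V (S s.1) v0) : F) *: s.2).
  split=> [v'|x]; last by multilin.
  move=> c x y.
  rewrite (cop_linear sw (f := fun a b => (vcoord j (act V (S a) v0) : F) *:
    b)); last by multilin.
  by rewrite scalerDr !scalerA mulrC.
pose psi j : 'Hom(tensor V A, A) := tlift (fun (v' : V) (x : A) =>
    (c0 v' : F) *: \sum_(s <- cop x) (vcoord j (act V (S s.1) v0) : F) *: s.2).
have psiE j v' x : psi j (v' ⊗ x) =
    (c0 v' : F) *: \sum_(s <- cop x) (vcoord j (act V (S s.1) v0) : F) *: s.2.
  by rewrite tlift_tens //; apply psib.
have Y (f : 'Hom(W, F^o)) w : \sum_(p <- cop t) (f (act W (S p.2) w) : F) *: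
  p.1 = 0.
  have : \sum_(j < \dim {:V}) psi j (\sum_(p <- cop t) \sum_(q <- cop p.1)
      (f (act W (S p.2) w) : F) *: (act V q.1 (vbasis {:V})`_j ⊗ q.2)) = 0.
    by rewrite big1 // => j _; rewrite Z linear0.
  move=> E; rewrite -[RHS]E; under [RHS]eq_bigr => j _ do rewrite lfun_sum.
  rewrite [RHS]exchange_big; apply: eq_bigr => p _ /=.
  under [RHS]eq_bigr => j _.
    rewrite linear_sum /=.
    under eq_bigr => q _ do rewrite linearZ /= psiE.
    rewrite -scaler_sumr; over.
  rewrite -scaler_sumr; congr (_ *: _).
  rewrite exchange_big /=.
  transitivity (\sum_(q <- cop p.1) \sum_(s <- cop q.2)
      (c0 (act V q.1 (act V (S s.1) v0)) : F) *: s.2); last first.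
    apply: eq_bigr => q _.
    under [RHS]eq_bigr => j _ do rewrite scaler_sumr.
    rewrite exchange_big /=; apply: eq_bigr => s _.
    rewrite {1}(vcoord_sum (act V (S s.1) v0)) !lfun_sum scaler_suml.
    by apply: eq_bigr => j _; rewrite !lfunZ scalerA mulrC.
  rewrite -(cop_coassoc sw (f := fun a b c =>
    (c0 (act V a (act V (S b) v0)) : F) *: c)); last by multilin.
  rewrite -[LHS](cop_counitl sw); apply: eq_bigr => q _.
  under eq_bigr => s _ do rewrite -actME.
  rewrite (antirE sw (h := fun z => (c0 (act V z v0) : F) *: q.2));
    last by multilin.
  by rewrite act1E c0v0 scale1r.
move: dW; rewrite lt0n dimv_eq0 => /negP[]; rewrite -subv0; apply/subvP => w _.
rewrite memv0 -[w]act1E -(scale1r 1) -t1 -antir linear_sum sum_lfunE; apply/eqP.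
transitivity (\sum_(i < \dim {:W}) act W
  (\sum_(p <- cop t) (vcoord i (act W (S p.2) w) : F) *: p.1) (vbasis {:W})`_i).
  under [RHS]eq_bigr => i _ do rewrite linear_sum sum_lfunE.
  rewrite [RHS]exchange_big; apply: eq_bigr => p _ /=.
  rewrite actME {1}(vcoord_sum (act W (S p.2) w)) linear_sum.
  by apply: eq_bigr => i _; rewrite !linearZ /= scale_lfunE.
by rewrite big1 // => i _; rewrite Y linear0 zero_lfunE.
Qed.

(** Linearity of [r] suffices: it makes id ⊗ [j] injective, so a nonzero intertwiner into V ⊗ A
    stays nonzero in V ⊗ X. *)
Lemma hdim_tens_gt0 (V W X : lmodule A) (j : 'Hom(regular A, X)) (r : 'Hom(X,
  A)) :
  intertwiner j -> cancel j r ->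
  (0 < \dim {:V})%N -> (0 < \dim {:W})%N -> (0 < hdim e W (tensm sw V X))%N.
Proof.
move=> ji jK dV dW; have [f fi f0] := hdim_gt0P (hdim_tens_regular_gt0 dV dW).
pose g : 'Hom(tensm sw V (regular A), tensm sw V X) := tmap (\1%VF : 'End(V)) j.
have gi : intertwiner g.
  move=> a x.
  have : (g \o act (tensm sw V (regular A)) a)%VF = (act (tensm sw V X) a \o
    g)%VF.
    apply: tensor_hom_ext => u b; rewrite !comp_lfunE.
    rewrite tensm_actE lfun_sum [X in act _ _ X]tmapE id_lfunE tensm_actE.
    by apply: eq_bigr => p _; rewrite [LHS]tmapE id_lfunE ji.
  by move=> /(congr1 (fun h : 'Hom(_, _) => h x)); rewrite !comp_lfunE.
apply: (@hdim_gt0 _ _ e _ _ (g \o f)%VF).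
  by move=> a x; rewrite !comp_lfunE fi gi.
apply: contraNN f0 => /eqP gf0.
pose g' : 'Hom(tensm sw V X, tensm sw V (regular A)) :=
  tmap (\1%VF : 'End(V)) (r : 'Hom(X, regular A)).
have g'g : (g' \o g)%VF = \1%VF.
  apply: tensor_hom_ext => u b; rewrite comp_lfunE id_lfunE.
  by rewrite [X in g' X]tmapE [LHS]tmapE !id_lfunE jK.
by rewrite -[f]comp_lfun1l -g'g -comp_lfunA gf0 comp_lfun0r.
Qed.

End TensorPositivity.

(** * Normal Hopf subalgebras *)

Section NormalHopfSubalgebra.
Variables (F : fieldType) (H : hopfAlgType F) (K : {aspace H}).
Hypothesis ssH : semisimple_algebra H.
Hypothesis hK : hopf_subalgebra K.
Hypothesis nK : normal_subspace K.

Local Notation sw := (hopf_sweedler H).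
Local Notation swK := (sub_sweedler hK).
Local Notation cop := (cop sw).
Local Notation epsH := (eps sw).
Local Notation S := (anti sw).

(** The component w of 1 in a left ideal complementary to the kernel of eps works: a w - eps(a) w
    lies in both summands. *)
Lemma semisimple_integral :
  exists t : H, (forall a, a * t = (epsH a : F) *: t) /\ epsH t = 1.
Proof.
have sU : @submodule _ _ (regular H) (lker epsH).
  move=> a u; rewrite !memv_ker regularE epsM => /eqP ->.
  by rewrite mulr0.
have [W [sW UW UW0]] := ssH sU.
have /memv_addP[u uU [w wW uw]] : (1 : H) \in (lker epsH + W)%VS by rewrite UW
  memvf.
have epsw : epsH w = 1.
  rewrite -(eps1 sw) uw lfunD; move: uU; rewrite memv_ker => /eqP ->.
  by rewrite add0r.
exists w; split=> // a; apply/eqP; rewrite -subr_eq0 -memv0 -UW0 memv_cap.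
have aW : a * w \in W by rewrite -regularE sW.
rewrite (rpredB aW) ?rpredZ // andbT memv_ker lfunB lfunZ.
by rewrite epsM epsw mulr1 -[X in _ - X]/(epsH a * 1) mulr1 subrr.
Qed.

Definition adl (h x : H) : H := \sum_(p <- cop h) p.1 * x * S p.2.
Definition adr (h x : H) : H := \sum_(p <- cop h) S p.1 * x * p.2.

Lemma adl_mem h x : x \in K -> adl h x \in K.
Proof.
move=> xK; have [+ _] := nK h xK; rewrite /adl.
by rewrite (hopf_cop_tlift (f := fun a b => a * x * S b)) //; multilin.
Qed.

Lemma adr_mem h x : x \in K -> adr h x \in K.
Proof.
move=> xK; have [_ +] := nK h xK; rewrite /adr.
by rewrite (hopf_cop_tlift (f := fun a b => S a * x * b)) //; multilin.
Qed.

Lemma eps_adr h x : epsH x = 0 -> epsH (adr h x) = 0.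
Proof.
by move=> x0; rewrite /adr lfun_sum big1 // => p _;
  rewrite !epsM x0 mulr0 mul0r.
Qed.

(** This rule and [mul_adl] move elements of K past elements of H at the price of an adjoint action;
    normality enters through them. *)
Lemma mul_adr h x : x * h = \sum_(p <- cop h) p.1 * adr p.2 x.
Proof.
under eq_bigr => p _ do rewrite mulr_sumr.
rewrite -(cop_coassoc sw (f := fun a b c => a * (S b * x * c)));
  last by multilin.
rewrite -(counitlE sw (h := fun a => x * a)); last by multilin.
apply: eq_bigr => p _; under eq_bigr => q _ do rewrite -mulrA (mulrA q.1).
rewrite (antirE sw (h := fun z => z * (x * p.2))); last by multilin.
by rewrite mul1r.
Qed.

Lemma mul_adl h x : h * x = \sum_(p <- cop h) adl p.1 x * p.2.
Proof.
under eq_bigr => p _ do rewrite mulr_suml.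
rewrite (cop_coassoc sw (f := fun a b c => a * x * S b * c)); last by multilin.
rewrite -(counitrE sw (h := fun a => a * x)); last by multilin.
apply: eq_bigr => p _; under eq_bigr => q _ do rewrite -mulrA.
rewrite (antilE sw (h := fun z => p.1 * x * z)); last by multilin.
by rewrite mulr1.
Qed.

Definition left_integral (x : H) :=
  x \in K /\ forall k, k \in K -> k * x = (epsH k : F) *: x.

Lemma mem1K : 1 \in K. Proof. by case: hK. Qed.

Lemma eps_split k : k \in K -> k - (epsH k : F) *: 1 \in K /\ epsH (k - (epsH k
  : F) *: 1) = 0.
Proof.
move=> kK; split; first by rewrite rpredB // rpredZ // mem1K.
by rewrite lfunB lfunZ eps1 -[X in _ - X]/(epsH k * 1) mulr1 subrr.
Qed.

(** For k in K with eps(k) = 0, k h_1 x S(h_2) = h_1 adr(h_2, k) x S(h_3), and adr(h_2, k) is again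
    such an element, so it annihilates x. *)
Lemma left_integral_adl h x : left_integral x -> left_integral (adl h x).
Proof.
move=> [xK xI]; split=> [|k kK]; first exact: adl_mem.
have [k'K k'0] := eps_split kK; set k' := k - _ in k'K k'0.
suff k'x : k' * adl h x = 0.
  by move: k'x; rewrite /k' mulrBl -scalerAl mul1r => /eqP;
    rewrite subr_eq0 => /eqP.
rewrite /adl mulr_sumr big1 // => p _;
  rewrite !mulrA (mul_adr p.1 k') !mulr_suml big1 // => q _.
rewrite -(mulrA q.1) xI ?adr_mem // eps_adr // scale0r.
by rewrite mulr0 mul0r.
Qed.

Lemma left_integral_neq0 : exists2 x, left_integral x & x != 0.
Proof.
have [v v0] := trace_integral_neq0 swK.
exists (vsval (trace_integral swK v)); last first.
  by apply: contraNN v0 => /eqP E; apply/eqP/subvs_inj; rewrite E linear0.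
split=> [|k kK]; first exact: subvsP.
have := trace_integralP swK v (Subvs kK) => /(congr1 vsval).
by rewrite sub_valM sub_valZ /= sub_epsE.
Qed.

(* If [eps] vanished on the integrals of [K], a nonzero integral [t] would    *)
(* satisfy [t h t = 0] for all [h], contradicting the semisimplicity of [H].   *)
Lemma left_integral_eps : exists2 x, left_integral x & epsH x = 1.
Proof.
have [x xI xe] : exists2 x, left_integral x & epsH x != 0.
  apply: contrapT => nI.
  have I0 x : left_integral x -> epsH x = 0.
    by move=> xI; apply/eqP/negPn/negP => xe; apply: nI; exists x.
  have [t tI t0] := left_integral_neq0; case/negP: t0; apply/eqP.
  have tt (h : H) : t * h * t = 0.
    rewrite -mulrA (mul_adl h t) mulr_sumr big1 // => p _; rewrite mulrA.
    have [_ ->] := left_integral_adl p.1 tI; last by case: tI.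
    by rewrite I0 // scale0r mul0r.
  pose Rt : 'End(H) := linfun (fun h => h * t).
  have RtE h : Rt h = h * t by apply: linfunE => c y z;
    rewrite mulrDl -scalerAl.
  have sU : @submodule _ _ (regular H) (limg Rt).
    move=> a _ /memv_imgP[h _ ->]; rewrite regularE RtE mulrA -RtE memv_img //.
    exact: memvf.
  have [W [sW UW UW0]] := ssH sU.
  have /memv_addP[_ /memv_imgP[h _ ->] [w wW uw]] : (1 : H) \in (limg Rt +
    W)%VS.
    by rewrite UW memvf.
  (* Since 1 = h t + w and t h t = 0, t lies in [W] as well as in H t. *)
  have tw : t = t * w by rewrite -{1}(mulr1 t) uw mulrDr RtE mulrA tt add0r.
  apply/eqP; rewrite -memv0 -UW0 memv_cap; apply/andP; split.
    by rewrite -(mul1r t) -RtE memv_img // memvf.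
  by rewrite tw -regularE sW.
exists ((epsH x : F)^-1 *: x); last by rewrite lfunZ /=; exact: mulVf.
case: xI => xK xI; split=> [|k kK]; first by rewrite rpredZ.
by rewrite -scalerAr xI // !scalerA mulrC.
Qed.

Lemma sub_integral : exists t : subvs_of K,
  (forall a, a * t = (eps swK a : F) *: t) /\ eps swK t = 1.
Proof.
have [x [xK xI] xe] := left_integral_eps.
exists (Subvs xK); split=> [a|]; last by rewrite [LHS]sub_epsE.
by apply: subvs_inj; rewrite sub_valM sub_valZ /= xI ?subvsP // sub_epsE.
Qed.

Lemma aug_mul_l h x : x \in augmentation_ideal K -> h * x \in
  augmentation_ideal K.
Proof.
move=> xJ; apply: (subvP (_ : ({:H} * augmentation_ideal K <= _)%VS)).
  by rewrite /augmentation_ideal prodvA prodvSl // subvf.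
by rewrite memv_mul ?memvf.
Qed.

Lemma aug_mem h k : k \in K -> epsH k = 0 -> h * k \in augmentation_ideal K.
Proof.
by move=> kK k0; rewrite memv_mul ?memvf // memv_cap kK memv_ker; apply/eqP.
Qed.

Lemma aug_ker (V : vectType F) (f : 'Hom(H, V)) :
  (forall h k, k \in K -> epsH k = 0 -> f (h * k) = 0) ->
  forall x, x \in augmentation_ideal K -> f x = 0.
Proof.
move=> fhk x xJ; apply/eqP; rewrite -memv_ker; apply: subvP x xJ.
apply/prodvP => h k _; rewrite memv_cap => /andP[kK];
  rewrite memv_ker => /eqP k0.
by rewrite memv_ker fhk.
Qed.

Lemma aug_mem_r h k : k \in K -> epsH k = 0 -> k * h \in augmentation_ideal K.
Proof.
move=> kK k0; rewrite mul_adr rpred_sum // => p _.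
by rewrite aug_mem ?adr_mem ?eps_adr.
Qed.

Lemma aug_mul_r h x : x \in augmentation_ideal K -> x * h \in
  augmentation_ideal K.
Proof.
move=> xJ; pose R : 'End(H) := linfun (fun y => y * h).
have RE y : R y = y * h by apply: linfunE => c u v; rewrite mulrDl -scalerAl.
have := @aug_ker _ (quov_pi (augmentation_ideal K) \o R)%VF _ x xJ.
rewrite comp_lfunE RE => E; rewrite -quov_pi_eq0 E // => g k kK k0.
apply/eqP; rewrite comp_lfunE RE quov_pi_eq0 -mulrA aug_mul_l //.
exact: aug_mem_r.
Qed.

Lemma aug_sub_eps k : k \in K -> k - (epsH k : F) *: 1 \in augmentation_ideal K.
Proof. by move=> /eps_split[kK k0]; rewrite -[_ - _]mul1r aug_mem. Qed.

(* [W] is the [H]-module [H // K], realized as a left ideal of [H].            *)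
Lemma aug_compl : exists (W : {vspace regular H}) (sW : submodule W) (e : H),
  [/\ e \in W, 1 - e \in augmentation_ideal K &
      forall k w, k \in K -> w \in W -> k * w = (epsH k : F) *: w].
Proof.
have sU : @submodule _ _ (regular H) (augmentation_ideal K).
  by move=> a u uJ; rewrite regularE aug_mul_l.
have [W [sW UW UW0]] := ssH sU.
have /memv_addP[u uU [w wW uw]] : (1 : H) \in (augmentation_ideal K + W)%VS.
  by rewrite UW memvf.
exists W, sW, w; split=> //; first by rewrite uw addrK.
move=> k x kK xW; apply/eqP; rewrite -subr_eq0 -memv0 -UW0 memv_cap.
have kx : k * x \in W by rewrite -regularE sW.
rewrite (rpredB kx) ?rpredZ // andbT.
have -> : k * x - (epsH k : F) *: x = (k - (epsH k : F) *: 1) * x.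
  by rewrite mulrBl -scalerAl mul1r.
by rewrite aug_mul_r // aug_sub_eps.
Qed.

End NormalHopfSubalgebra.

(** * Restriction and induction *)

Section Restriction.
Variables (F : fieldType) (A : falgType F) (B : {aspace A}).
Hypothesis B1 : 1 \in B.
Variable M : lmodule A.

Definition res_act : 'Hom(subvs_of B, 'End(M)) := (act M \o linfun vsval)%VF.

Lemma res_actE b : res_act b = act M (vsval b).
Proof. by rewrite comp_lfunE lfunE. Qed.

Fact res_act1 : res_act 1 = \1%VF.
Proof.
rewrite res_actE -[vsval 1]/(algid B).
have -> : algid B = 1 by apply/eqP; rewrite algid_eq1.
exact: act1.
Qed.

Fact res_actM x y : res_act (x * y) = (res_act x \o res_act y)%VF.
Proof. by rewrite !res_actE -actM. Qed.

Definition res_module : lmodule (subvs_of B) := LModule res_act1 res_actM.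

Lemma res_moduleE b (x : M) : act res_module b x = act M (vsval b) x.
Proof. by rewrite -res_actE. Qed.

Lemma character_res : character res_module = res B (character M).
Proof.
apply/lfunP => b; rewrite [RHS]comp_lfunE !characterE.
by congr lfun_trace; rewrite [LHS]res_actE [linfun _ _]lfunE.
Qed.

End Restriction.

Section Frobenius.
Variables (F : fieldType) (A : falgType F) (B : {aspace A}).
Hypothesis B1 : 1 \in B.
Variables (eA : separability A) (eB : separability (subvs_of B)).
Variables (V : lmodule (subvs_of B)) (M : lmodule A).

Lemma btens_linear (a : A) : linear (fun m : V => btens a m : induced V).
Proof. by move=> c x y; rewrite /btens tens_linearr linearP. Qed.

(** [balancing] imposes the relation only for b in a basis; it extends by linearity in b. *)
Lemma btens_balance a b (m : V) : btens (a * vsval b) m = btens a (act V b m).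
Proof.
apply/eqP; rewrite -subr_eq0.
pose h (c : subvs_of B) : btensor V := btens (a * vsval c) m - btens a (act V c
  m).
have l1 : linear (fun c : subvs_of B => btens (a * vsval c) m : btensor V).
  by rewrite /btens; multilin.
have l2 : linear (fun c : subvs_of B => btens a (act V c m) : btensor V).
  by rewrite /btens; multilin.
have hl : linear h.
  by move=> k x y; rewrite /h l1 l2 scalerBr opprD addrACA.
rewrite -/(h b) (coord_vbasis (memvf b)) (linear_fun_sum hl) big1 // => i _.
rewrite (linear_funZ hl) /h /btens -lfunB.
apply/eqP; rewrite scaler_eq0 quov_pi_eq0; apply/orP; right.
rewrite -balanceE /balancing (big_rem (vbasis {:subvs_of B})`_i) /=; last first.
  by rewrite mem_nth // size_tuple.
by apply: (subvP (addvSl _ _)); rewrite memv_img // memvf.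
Qed.

Lemma induced_extend (g : 'Hom(V, M)) :
  (forall b m, g (act V b m) = act M (vsval b) (g m)) ->
  exists f : 'Hom(induced V, M),
    intertwiner f /\ forall a m, f (btens a m) = act M a (g m).
Proof.
move=> gi; pose G : 'Hom(tensor A V, M) := tlift (fun a m => act M a (g m)).
have GE a m : G (a ⊗ m) = act M a (g m).
  by rewrite tlift_tens // => u; multilin.
have G0 t : t \in balancing V -> G t = 0.
  move=> tb; apply/eqP; rewrite -memv_ker; apply: subvP t tb.
  rewrite /balancing big_seq; elim/big_rec: _ => [|b U _ UB];
    first exact: sub0v.
  rewrite subv_add UB andbT; apply/subvP => _ /memv_imgP[t _ ->].
  rewrite memv_ker -comp_lfunE; set T := tlift _.
  have -> : (G \o T)%VF = 0.
    apply: tensor_hom_ext => a m;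
      rewrite comp_lfunE /T balanceE lfunB !GE gi actME.
    by rewrite subrr zero_lfunE.
  by rewrite zero_lfunE.
have Gr t : G (quov_repr (balancing V) (quov_pi (balancing V) t)) = G t.
  by apply/eqP; rewrite eq_sym -subr_eq0 -lfunB; apply/eqP/G0/quov_piK.
exists (G \o quov_repr (balancing V))%VF; split=> [a x|a m]; last first.
  by rewrite comp_lfunE Gr GE.
rewrite !comp_lfunE -[x in LHS]quov_reprK [act _ _ _]ind_act_pi Gr.
have E : (G \o ind_lmul V a)%VF = (act M a \o G)%VF.
  by apply: tensor_hom_ext => b m; rewrite !comp_lfunE ind_lmulE !GE actME.
by rewrite -(comp_lfunE G) E comp_lfunE.
Qed.

(** Frobenius reciprocity: f |-> f(1 ⊗ -) is injective on intertwiners because 1 ⊗ V generates the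
    induced module, and [induced_extend] gives surjectivity onto the B-linear maps. *)
Lemma hdim_induced : hdim eA (induced V) M = hdim eB V (res_module B1 M).
Proof.
pose i : 'Hom(V, induced V) := linfun (fun m : V => btens 1 m : induced V).
have iE m : i m = btens 1 m by exact: (linfunE (btens_linear 1)).
have actE a x m : act (induced V) a (btens x m) = btens (a * x) m.
  exact: ind_actE.
pose r : 'Hom('Hom(induced V, M), 'Hom(V, res_module B1 M)) :=
  linfun (sandwich ((\1%VF : 'End(M)) : 'Hom(M, res_module B1 M)) i).
have rE f m : r f m = f (btens 1 m).
  by rewrite lfunE /= /sandwich !comp_lfunE id_lfunE iE.
have btE a m : btens a m = act (induced V) a (btens 1 m) by rewrite actE mulr1.
rewrite /hdim -(@limg_dim_eq _ _ _ r); last first.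
  apply/eqP; rewrite -subv0; apply/subvP => f; rewrite memv_cap memv_ker memv0.
  move=> /andP[/mem_limg_avg fi /eqP rf0]; apply/eqP/lfunP => x.
  rewrite zero_lfunE -[x]quov_reprK.
  suff f0 : (f \o quov_pi (balancing V))%VF = 0.
    have := congr1 (fun h : 'Hom(tensor A V, M) => h (quov_repr _ x)) f0.
    by rewrite comp_lfunE zero_lfunE.
  apply: tensor_hom_ext => a m; rewrite comp_lfunE zero_lfunE -/(btens a m).
  by rewrite btE fi -rE rf0 zero_lfunE linear0.
congr (\dim _); apply/vspaceP => g; apply/idP/idP.
  move=> /memv_imgP[f /mem_limg_avg fi ->].
  apply/(@mem_limg_avg _ _ eB V (res_module B1 M)) => b m.
  by rewrite res_moduleE !rE -fi -btE -[vsval b]mul1r btens_balance.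
move=> /(@mem_limg_avg _ _ eB V (res_module B1 M)) gi.
have [|f [fi fE]] := @induced_extend g; first by move=> b m;
  rewrite gi res_moduleE.
apply/memv_imgP; exists f; first exact/mem_limg_avg.
by apply/lfunP => m; rewrite rE fE act1E.
Qed.

End Frobenius.

(** * The coset relation *)

Section Coset.
Variables (F : fieldType) (H : hopfAlgType F) (K : {aspace H}).
Hypothesis hK : hopf_subalgebra K.
Hypothesis nK : normal_subspace K.
Variable eK : separability (subvs_of K).

Local Notation sw := (hopf_sweedler H).
Local Notation swK := (sub_sweedler hK).
Local Notation cop := (cop sw).
Local Notation eps := (eps sw).
Local Notation S := (anti sw).
Local Notation rmod := (res_module (mem1K hK)).

Section Conjugate.
Variables (M N : lmodule H) (phi : 'Hom(N, M)).
Hypothesis phiK : forall k x, k \in K -> phi (act N k x) = act M k (phi x).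

(* For [K]-linear [phi], the map [h |-> h_1 phi S(h_2)] vanishes on [H K^+],   *)
(* so its matrix coefficients belong to [L^*].                                 *)
Definition conjugate_fun (h : H) : 'Hom(N, M) :=
  \sum_(p <- cop h) (act M p.1 \o phi \o act N (S p.2))%VF.

Lemma conjugate_bilin :
  bilinear_fun (fun a b => (act M a \o phi \o act N (S b))%VF : 'Hom(N, M)).
Proof. by multilin. Qed.

Lemma conjugate_linear : linear conjugate_fun.
Proof. exact: (cop_linear sw conjugate_bilin). Qed.

Definition conjugate : 'Hom(H, 'Hom(N, M)) := linfun conjugate_fun.

Lemma conjugateE h x :
  conjugate h x = \sum_(p <- cop h) act M p.1 (phi (act N (S p.2) x)).
Proof.
rewrite (linfunE conjugate_linear) sum_lfunE.
by apply: eq_bigr => p _; rewrite !comp_lfunE.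
Qed.

Lemma conjugate1 : conjugate 1 = phi.
Proof.
rewrite (linfunE conjugate_linear) /conjugate_fun (cop1 sw conjugate_bilin).
rewrite anti1; apply/lfunP => x.
by rewrite !comp_lfunE !act1E.
Qed.

Lemma conjugate_aug h : h \in augmentation_ideal K -> conjugate h = 0.
Proof.
apply: aug_ker => {}h k kK k0; apply/lfunP => x; rewrite conjugateE zero_lfunE.
rewrite (copM sw (f := fun a b => act M a (phi (act N (S b) x))));
  last by multilin.
rewrite big1 // => p _; under eq_bigr => q _ do rewrite antiM !actME.
have -> : k = vsval (Subvs kK) by [].
rewrite -(sub_cop_val hK (f := fun a b =>
  act M p.1 (act M a (phi (act N (S b) (act N (S p.2) x)))))); last by multilin.
under eq_bigr => q _ do rewrite -phiK ?subvsP // -actME.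
rewrite (sub_cop_val hK (f := fun a b =>
  act M p.1 (phi (act N (a * S b) (act N (S p.2) x))))); last by multilin.
rewrite (antirE sw (h := fun z => act M p.1 (phi (act N z (act N (S p.2)
  x))))); last by multilin.
by rewrite /= k0 scale0r.
Qed.

(** Here S(a_2) a_3 cancels. The identity makes h ⊗ x |-> [conjugate] h x an H-linear map from H ⊗
    N, with diagonal action, to M. *)
Lemma conjugate_mul a h x :
  \sum_(p <- cop a) conjugate (p.1 * h) (act N p.2 x) = act M a (conjugate h x).
Proof.
under eq_bigr => p _.
  rewrite conjugateE.
  rewrite (copM sw (f := fun a b => act M a (phi (act N (S b) (act N p.2
    x))))); last by multilin.
  over.
rewrite (cop_coassoc sw (f := fun a b c => \sum_(q <- cop h)
   act M (a * q.1) (phi (act N (S (b * q.2)) (act N c x))))); last by multilin.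
rewrite -[in RHS](cop_counitr sw a) lfun_sum sum_lfunE; apply: eq_bigr => p _.
rewrite exchange_big lfunZ scale_lfunE conjugateE lfun_sum scaler_sumr.
apply: eq_bigr => q _; under eq_bigr => s _ do rewrite antiM -actME -mulrA.
rewrite (antilE sw (h := fun z => act M (p.1 * q.1) (phi (act N (S q.2 * z)
  x)))); last by multilin.
by rewrite mulr1 actME.
Qed.

End Conjugate.

(** With [quotient_dual_aug], this identifies L^* with the annihilator of H K^+. *)
Lemma quotient_dual_mem (f : dual H) :
  (forall x, x \in augmentation_ideal K -> f x = 0) -> f \in quotient_dual K.
Proof.
move=> f0; apply/memv_imgP.
exists (f \o quov_repr (augmentation_ideal K))%VF; rewrite ?memvf //.
rewrite lfunE; apply/lfunP => x; rewrite [RHS]comp_lfunE [RHS]comp_lfunE.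
by apply/eqP; rewrite -subr_eq0 -lfunB; apply/eqP/f0; exact: quov_piK.
Qed.

Lemma quotient_dual_aug (f : dual H) x :
  f \in quotient_dual K -> x \in augmentation_ideal K -> f x = 0.
Proof.
move=> /memv_imgP[g _ ->] xJ; rewrite lfunE [LHS]comp_lfunE.
have /eqP -> : hopf_proj K x == 0 by rewrite quov_pi_eq0.
by rewrite linear0.
Qed.

Lemma convolutionE (f g : dual H) h :
  convolution f g h = \sum_(p <- cop h) f p.1 * g p.2.
Proof.
by rewrite (hopf_cop_tlift (f := fun a b => f a * g b : F^o)) ?comp_lfunE //;
  multilin.
Qed.

Lemma convolution_bilin : bilinear_fun (@convolution F H).
Proof.
split=> f c g1 g2; apply/lfunP => h;
  rewrite add_lfunE scale_lfunE !convolutionE scaler_sumr -big_split /=;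
  apply: eq_bigr => p _; rewrite add_lfunE scale_lfunE.
  by rewrite mulrDr -scalerAr.
by rewrite mulrDl -scalerAl.
Qed.

Lemma convolutionv_mem (U W : {vspace dual H}) f g :
  f \in U -> g \in W -> convolution f g \in convolutionv U W.
Proof.
move=> fU gW; have [cr cl] := convolution_bilin.
rewrite (coord_vbasis fU) (linear_fun_sum (cl g)) rpred_sum // => i _.
rewrite (linear_funZ (cl g)) rpredZ //.
rewrite (coord_vbasis gW) (linear_fun_sum (cr _)) rpred_sum // => j _.
rewrite (linear_funZ (cr _)) rpredZ // memv_span //.
by apply: allpairs_f; rewrite mem_nth // size_tuple.
Qed.

Definition coef (M : lmodule H) (f : 'Hom(M, F^o)) (m : M) : dual H :=
  linfun (fun h => f (act M h m)).

Lemma coefE M f m h : @coef M f m h = f (act M h m).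
Proof. by apply: linfunE; multilin. Qed.

Lemma coef_mem M f m : @coef M f m \in coefs M.
Proof.
have -> : coef f m = \sum_(i < \dim {:M}) \sum_(j < \dim {:M})
    (f (vbasis {:M})`_i * vcoord j m : F) *: linfun (@mcoef_fun _ _ M i j).
  apply/lfunP => h; rewrite coefE sum_lfunE.
  rewrite {1}(vcoord_sum (act M h m)) lfun_sum; apply: eq_bigr => i _.
  rewrite {1}(vcoord_sum m) lfunZ !lfun_sum sum_lfunE scaler_suml.
  apply: eq_bigr => j _; rewrite scale_lfunE !lfunZ.
  have -> : linfun (mcoef_fun i j) h = vcoord i (act M h (vbasis {:M})`_j).
    by rewrite [LHS]lfunE [RHS]lfunE.
  by rewrite -[LHS]/(_ * _ * _) -[RHS]/(_ * _ * _) mulrC mulrA.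
rewrite rpred_sum // => i _; rewrite rpred_sum // => j _; rewrite rpredZ //.
by rewrite memv_span //; apply: allpairs_f; rewrite mem_enum.
Qed.

Lemma coefs_sub (M : lmodule H) (U : {vspace dual H}) :
  (forall f m, @coef M f m \in U) -> (coefs M <= U)%VS.
Proof.
move=> cU; apply/span_subvP => _ /allpairsP[[i j] /= [_ _ ->]].
suff -> : linfun (@mcoef_fun _ _ M i j) = coef (vcoord i) (vbasis {:M})`_j by
  [].
by apply/lfunP => h; rewrite coefE [LHS]lfunE [RHS]lfunE.
Qed.

(** The left H-module structure of H^*. Both L^* and the coefficient spaces are stable under it,
    hence so are their products. *)
Definition rtrans (b : H) (f : dual H) : dual H := linfun (fun h => f (h * b)).

Lemma rtransE b f h : rtrans b f h = f (h * b).
Proof. by apply: linfunE; multilin. Qed.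

Lemma rtrans_linear b : linear (rtrans b).
Proof.
move=> c f g; apply/lfunP => h.
by rewrite add_lfunE scale_lfunE !rtransE add_lfunE scale_lfunE.
Qed.

Lemma rtrans_coef (M : lmodule H) (f : 'Hom(M, F^o)) m b : rtrans b (coef f m)
  = coef f (act M b m).
Proof. by apply/lfunP => h; rewrite rtransE !coefE actME. Qed.

Lemma quotient_dual_rtrans f b : f \in quotient_dual K -> rtrans b f \in
  quotient_dual K.
Proof.
move=> fQ; apply: quotient_dual_mem => x xJ; rewrite rtransE.
by apply: quotient_dual_aug => //; exact: aug_mul_r.
Qed.

Lemma coefs_rtrans (N : lmodule H) g b : g \in coefs N -> rtrans b g \in coefs
  N.
Proof.
move=> gN; rewrite -(linfunE (rtrans_linear b)) memv_preim; apply: subvP gN.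
apply: coefs_sub => f m; rewrite -memv_preim (linfunE (rtrans_linear b)).
by rewrite rtrans_coef coef_mem.
Qed.

Lemma rtrans_convolution b f g : rtrans b (convolution f g) =
  \sum_(q <- cop b) convolution (rtrans q.1 f) (rtrans q.2 g).
Proof.
apply/lfunP => h; rewrite rtransE sum_lfunE convolutionE.
rewrite (copM sw (f := fun a b => f a * g b : F^o)); last by multilin.
rewrite exchange_big; apply: eq_bigr => q _; rewrite convolutionE.
by apply: eq_bigr => p _; rewrite !rtransE.
Qed.

Lemma convolutionv_rtrans (N : lmodule H) b f :
  f \in convolutionv (quotient_dual K) (coefs N) ->
  rtrans b f \in convolutionv (quotient_dual K) (coefs N).
Proof.
move=> fX; rewrite -(linfunE (rtrans_linear b)) memv_preim; apply: subvP fX.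
apply/span_subvP => _ /allpairsP[[g h] /= [/vbasis_mem gQ /vbasis_mem hN ->]].
rewrite -memv_preim (linfunE (rtrans_linear b)) rtrans_convolution rpred_sum //
  => q _.
by rewrite convolutionv_mem ?quotient_dual_rtrans ?coefs_rtrans.
Qed.

(** The vectors of M whose coefficients all lie in L^* C_N form a submodule. It contains the image
    of phi, since h phi(n) is [conjugate] at h_1 applied to h_2 n, so by simplicity it is M. *)
Lemma coefs_sub_convolutionv (M N : lmodule H) (phi : 'Hom(N, M)) :
  simple_module M ->
  (forall k x, k \in K -> phi (act N k x) = act M k (phi x)) -> phi != 0 ->
  (coefs M <= convolutionv (quotient_dual K) (coefs N))%VS.
Proof.
move=> [_ sM] phiK phi0; set X := convolutionv _ _.
have coefl (f : 'Hom(M, F^o)) : linear (fun m => coef f m).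
  move=> c x y; apply/lfunP => h.
  by rewrite add_lfunE scale_lfunE !coefE linearP linearP.
pose T i : 'Hom(M, dual H) := linfun (fun m => coef (vcoord i) m).
pose U := (\bigcap_(i < \dim {:M}) (T i @^-1: X))%VS.
have memU m : m \in U <-> forall f, coef f m \in X.
  split=> [mU f|fX]; last first.
    rewrite memvE; apply/subv_bigcapP => i _.
    by rewrite -memvE -memv_preim (linfunE (coefl _)).
  have -> : coef f m = \sum_(i < \dim {:M}) (f (vbasis {:M})`_i : F) *: T i m.
    apply/lfunP => h; rewrite coefE sum_lfunE.
    rewrite {1}(vcoord_sum (act M h m)) lfun_sum; apply: eq_bigr => i _.
    rewrite scale_lfunE (linfunE (coefl _)) coefE lfunZ.
    by rewrite -[LHS]/(_ * _) -[RHS]/(_ * _) mulrC.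
  rewrite rpred_sum // => i _; rewrite rpredZ // memv_preim.
  by move: mU; rewrite memvE => /subv_bigcapP/(_ i isT); rewrite -memvE.
have sU : submodule U.
  move=> b m /memU mX; apply/memU => f.
  by rewrite -rtrans_coef convolutionv_rtrans.
have phiU n : phi n \in U.
  apply/memU => f.
  pose cc j : dual H := linfun (fun h => f (conjugate phi h (vbasis {:N})`_j)).
  have ccE j h : cc j h = f (conjugate phi h (vbasis {:N})`_j).
    by apply: linfunE; multilin.
  have -> : coef f (phi n) = \sum_(j < \dim {:N})
      convolution (cc j) (coef (vcoord j) n).
    apply/lfunP => h; rewrite coefE sum_lfunE.
    under [RHS]eq_bigr => j _ do rewrite convolutionE.
    rewrite exchange_big -{1}(mulr1 h) -{1}(conjugate1 phi) actME act1E.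
    have := conjugate_mul phi h 1 n; rewrite conjugate1 => <-.
    rewrite lfun_sum; apply: eq_bigr => p _.
    rewrite mulr1 {1}(vcoord_sum (act N p.2 n)) !lfun_sum;
      apply: eq_bigr => j _.
    by rewrite ccE coefE !lfunZ -[LHS]/(_ * _) mulrC.
  rewrite rpred_sum // => j _; rewrite convolutionv_mem ?coef_mem //.
  apply: quotient_dual_mem => x xJ; rewrite ccE.
  by rewrite conjugate_aug // zero_lfunE linear0.
case: (sM U sU) => UE.
  case/negP: phi0; apply/eqP/lfunP => x; apply/eqP.
  by rewrite zero_lfunE -memv0 -UE phiU.
by apply: coefs_sub => f m; move: f; apply/memU; rewrite UE memvf.
Qed.

Lemma ip_res_linear g : linear (fun f => ip eK g (res K f) : F^o).
Proof.
have resl : linear (@res F H K).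
  move=> c f h; apply/lfunP => x.
  by rewrite add_lfunE scale_lfunE !comp_lfunE add_lfunE scale_lfunE.
by move=> c f h; rewrite resl ip_is_linearr.
Qed.

(** The pairing with a coefficient of N is a sum of coordinates of averaged rank one maps N -> M,
    and these averages are K-linear. *)
Lemma ip_res_coef (M N : lmodule H) f : hdim eK (rmod N) (rmod M) = 0%N ->
  f \in coefs N -> ip eK (res K (character M)) (res K f) = 0.
Proof.
move=> h0 fN.
pose L : dual H -> F^o := fun f => ip eK (res K (character M)) (res K f).
have Ll : linear L by exact: ip_res_linear.
suff : f \in lker (linfun L) by rewrite memv_ker (linfunE Ll) => /eqP.
apply: subvP fN.
apply: coefs_sub => g n; rewrite memv_ker (linfunE Ll) /L /ip; apply/eqP.
have resE (u : dual H) k : res K u k = u (vsval k).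
  by rewrite comp_lfunE [linfun _ _]lfunE.
transitivity (\sum_(j < \dim {:M}) \sum_(p <- eK)
   vcoord j (act (rmod M) p.1 (rank1 g (vbasis {:M})`_j (act (rmod N) p.2 n)))).
  rewrite exchange_big; apply: eq_bigr => p _.
  rewrite !resE characterE coefE /lfun_trace mulr_suml; apply: eq_bigr => j _.
  rewrite !res_moduleE rank1E !lfunZ [vcoord j _]lfunE.
  by rewrite -[RHS]/(_ * _) mulrC.
rewrite big1 // => j _;
  rewrite -lfun_sum -(avgxE eK (M := rmod N) (N := rmod M)).
by rewrite hdim_eq0 // zero_lfunE linear0.
Qed.

(** If Hom_K(N, M) = 0, pairing on K with the character of M kills C_N. An f in L^* restricts to
    f(1) eps on K, so the pairing also kills L^* C_N, hence the character of M itself, contrary to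
    the assumption on End_K(M). *)
Lemma hdim_gt0_of_coefs (M N : lmodule H) :
  (coefs M <= convolutionv (quotient_dual K) (coefs N))%VS ->
  (hdim eK (rmod M) (rmod M))%:R != 0 :> F ->
  (0 < hdim eK (rmod N) (rmod M))%N.
Proof.
move=> sub; apply: contraNT; rewrite -leqNgt leqn0 => /eqP h0.
rewrite -ip_character !character_res.
pose L : dual H -> F^o := fun f => ip eK (res K (character M)) (res K f).
have Ll : linear L by exact: ip_res_linear.
suff : character M \in lker (linfun L) by rewrite memv_ker (linfunE Ll).
have charM : character M \in coefs M.
  have -> : character M = \sum_(i < \dim {:M}) coef (vcoord i) (vbasis {:M})`_i.
    apply/lfunP => h; rewrite characterE sum_lfunE; apply: eq_bigr => i _.
    by rewrite coefE [RHS]lfunE.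
  by rewrite rpred_sum // => i _; rewrite coef_mem.
apply: subvP (subvP sub _ charM).
apply/span_subvP => _ /allpairsP[[f g] /= [/vbasis_mem fQ /vbasis_mem gN ->]].
rewrite memv_ker (linfunE Ll).
have -> : L (convolution f g) = f 1 * L g.
  suff E : res K (convolution f g) = (f 1 : F) *: res K g.
    by rewrite /L E (linear_funZ (ip_is_linearr eK _)).
  have resE (u : dual H) k : res K u k = u (vsval k).
    by rewrite comp_lfunE [linfun _ _]lfunE.
  apply/lfunP => k; rewrite scale_lfunE !resE.
  rewrite convolutionE -(sub_cop_val hK (f := fun a b => f a * g b : F^o));
    last by multilin.
  have f1 x : x \in K -> f x = (eps x : F) *: f 1.
    move=> xK; apply/eqP; rewrite -subr_eq0 -lfunZ -lfunB; apply/eqP.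
    by apply: (quotient_dual_aug fQ); exact: aug_sub_eps.
  under eq_bigr => p _ do rewrite f1 ?subvsP // -sub_epsE -scalerAl.
  by rewrite (counitlE swK (h := fun x => f 1 * g (vsval x) : F^o)) //;
    multilin.
by rewrite /L (ip_res_coef h0) // mulr0.
Qed.

End Coset.

(** * Tensoring with H // K *)

Section QuotientTensor.
Variables (F : fieldType) (H : hopfAlgType F) (K : {aspace H}).
Hypothesis hK : hopf_subalgebra K.
Variable eH : separability H.

Local Notation sw := (hopf_sweedler H).
Local Notation swK := (sub_sweedler hK).
Local Notation cop := (cop sw).
Local Notation eps := (eps sw).

Variables (W : {vspace regular H}) (sW : submodule W) (e : H).
Hypothesis eW : e \in W.
Hypothesis e1 : 1 - e \in augmentation_ideal K.
Hypothesis epsW : forall k w, k \in K -> w \in W -> k * w = (eps k : F) *: w.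

(** The map w ⊗ n |-> [conjugate] w n is H-linear by [conjugate_mul], and nonzero because e is 1
    modulo H K^+, so that conjugating at e returns phi. *)
Lemma hdim_quotient_tens (M N : lmodule H) (phi : 'Hom(N, M)) :
  (forall k x, k \in K -> phi (act N k x) = act M k (phi x)) -> phi != 0 ->
  (0 < hdim eH (tensm sw (submod sW) N) M)%N.
Proof.
move=> phiK phi0.
pose Phi : 'Hom(tensm sw (submod sW) N, M) :=
  tlift (fun (w : submod sW) n => conjugate phi (vsval w) n).
have PhiE (w : submod sW) n : Phi (w ⊗ n) = conjugate phi (vsval w) n.
  by rewrite [LHS]tlift_tens // => u; multilin.
have conj_e : conjugate phi e = phi.
  apply/eqP; rewrite -[X in _ == X](conjugate1 phi) eq_sym -subr_eq0 -lfunB.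
  by rewrite (conjugate_aug hK phiK).
apply: (@hdim_gt0 _ _ _ _ _ Phi).
  move=> a x.
  have E : (Phi \o act (tensm sw (submod sW) N) a)%VF = (act M a \o Phi)%VF.
    apply: tensor_hom_ext => w n; rewrite [LHS]comp_lfunE [RHS]comp_lfunE.
    rewrite tensm_actE lfun_sum PhiE -conjugate_mul.
    apply: eq_bigr => p _; rewrite PhiE; congr (fun_of_lfun (conjugate _ _) _).
    by rewrite submod_actE regularE.
  have := congr1 (fun g : 'Hom(tensor (submod sW) N, M) => g x) E.
  by rewrite [LHS]comp_lfunE [RHS]comp_lfunE.
apply: contraNN phi0 => /eqP Phi0; apply/eqP/lfunP => n.
have := PhiE (Subvs eW) n; rewrite Phi0 [LHS]zero_lfunE => E.
by rewrite zero_lfunE -conj_e E.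
Qed.

(** K acts on [W] through the counit. *)
Lemma character_quotient_tens (N : lmodule H) k : k \in K ->
  character (tensm sw (submod sW) N) k = (\dim W)%:R * character N k.
Proof.
move=> kK; rewrite character_tensm.
have -> : k = vsval (Subvs kK) by [].
rewrite -(sub_cop_val hK (f := fun a b =>
  character (submod sW) a * character N b : F^o)); last by multilin.
have cW b : b \in K -> character (submod sW) b = eps b * (\dim W)%:R.
  move=> bK; rewrite characterE.
  have -> : act (submod sW) b = (eps b : F) *: \1%VF.
    apply/lfunP => w; rewrite scale_lfunE id_lfunE; apply: subvs_inj.
    by rewrite [LHS]submod_actE regularE epsW // subvsP.
  rewrite (linear_funZ (@lfun_trace_is_linear _ _)) lfun_trace_id.
  by rewrite dimvf /dim.
under eq_bigr => p _ do rewrite cW ?subvsP // -sub_epsE -mulrA.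
rewrite (counitlE swK (h := fun x => (\dim W)%:R * character N (vsval x) :
  F^o)) //.
by multilin.
Qed.

End QuotientTensor.

(** * The regular module restricted to K *)

Section RegularRestriction.
Variables (F : fieldType) (H : hopfAlgType F) (K : {aspace H}).
Hypothesis hK : hopf_subalgebra K.

Local Notation sw := (hopf_sweedler H).
Local Notation swK := (sub_sweedler hK).
Local Notation rmod := (res_module (mem1K hK)).
Local Notation X := (rmod (regular H)).

Lemma res_moduleK (M : lmodule H) k : character (rmod M) k = character M (vsval
  k).
Proof. by rewrite !characterE; congr lfun_trace; apply/lfunP => x;
  exact: res_moduleE. Qed.

Lemma character_res_regular_tens k :
  character (tensm swK X X) k = (\dim {:H})%:R * character X k.
Proof.
rewrite character_tensm.
under eq_bigr => p _ do rewrite !res_moduleK.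
rewrite (sub_cop_val hK (f := fun a b =>
  character (regular H) a * character (regular H) b : F^o)); last by multilin.
by rewrite -character_tensm character_regular_tens res_moduleK character1.
Qed.

Lemma hdim_res_regular_gt0 t tI t1 (V W : lmodule (subvs_of K)) :
  (0 < \dim {:V})%N -> (0 < \dim {:W})%N ->
  (0 < hdim (@integral_separability _ _ swK t tI t1) W (tensm swK V X))%N.
Proof.
pose j : 'Hom(regular (subvs_of K), X) := linfun (@vsval _ _ K).
pose r : 'Hom(X, subvs_of K) := linfun (@vsproj _ _ K).
have jE x : j x = vsval x by rewrite lfunE.
apply: (@hdim_tens_gt0 _ _ _ _ _ _ _ _ _ j r) => [a x|x].
  by rewrite res_moduleE !jE !regularE.
by rewrite jE [LHS]lfunE /= vsvalK.
Qed.

End RegularRestriction.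

(** * Restriction multiplicities *)

(* Perron-Frobenius for a nonnegative matrix with two eigenvectors [p], [q] of *)
(* the same eigenvalue: the set where [q / p] is maximal is closed under the   *)
(* adjacency relation of the matrix.                                           *)
Section Perron.
Local Open Scope nat_scope.
Variables (n : nat) (N : 'I_n -> 'I_n -> nat) (p q : 'I_n -> nat) (c : nat).
Hypothesis Np : forall j, \sum_i p i * N i j = c * p j.
Hypothesis Nq : forall j, \sum_i q i * N i j = c * q j.
Hypothesis p_gt0 : forall i, 0 < p i.

Lemma ratio_argmax (i1 : 'I_n) : exists i0, forall i, q i * p i0 <= q i0 * p i.
Proof.
pose f i : rat := (q i)%:R / (p i)%:R.
case: (Order.TotalTheory.arg_maxP (i0 := i1) (P := xpredT) f isT) => i0 _ i0max.
exists i0 => i; have := i0max i isT; rewrite /f /Order.ge /=.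
rewrite Num.Theory.ler_pdivrMr ?Num.Theory.ltr0n // mulrAC.
rewrite Num.Theory.ler_pdivlMr ?Num.Theory.ltr0n //.
by rewrite -!natrM Num.Theory.ler_nat.
Qed.

(** Weighted by [N i i0] and summed, both sides of the inequality become c q_i0 p_i0, so equality
    holds in every term of positive weight. *)
Lemma ratio_max_closed i0 : (forall i, q i * p i0 <= q i0 * p i) ->
  forall i, 0 < N i i0 -> q i * p i0 = q i0 * p i.
Proof.
move=> imax i Ni.
have le j : q j * p i0 * N j i0 <= q i0 * p j * N j i0 by rewrite leq_mul2r
  imax orbT.
have := leqif_sum (fun j (_ : xpredT j) => leqif_eq (le j)) => -[_].
have -> : \sum_j q j * p i0 * N j i0 = \sum_j q i0 * p j * N j i0.
  under eq_bigr => j _ do rewrite mulnAC.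
  under [RHS]eq_bigr => j _ do rewrite -mulnA.
  by rewrite -big_distrl /= Nq -big_distrr /= Np mulnCA mulnA.
rewrite eqxx => /esym/forallP/(_ i) /=.
by rewrite eqn_pmul2r // => /eqP.
Qed.

End Perron.

Section CharacterSums.
Variables (F : numClosedFieldType) (A : falgType F) (e : separability A).
Variables (n : nat) (M : 'I_n -> lmodule A).

Definition simple_system : Prop :=
  [/\ forall i, simple_module (M i), injective (fun i => character (M i)) &
      forall f, Irr A f -> exists i, character (M i) = f].

Hypothesis MS : simple_system.

Lemma simple_system_enum : irr_enum (fun i => character (M i)).
Proof.
case: MS => sM inj sur; split=> // f; split=> [|[i <-]]; first exact: sur.
by exists (M i).
Qed.

Lemma character_hdim (X : lmodule A) :
  character X = \sum_i (hdim e X (M i))%:R *: character (M i).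
Proof.
rewrite {1}(character_sum e simple_system_enum X).
by apply: eq_bigr => i _; rewrite ip_character.
Qed.

Lemma simple_dim i : (0 < \dim {:M i})%N.
Proof. by case: MS => sM _ _; exact: simple_dim_gt0. Qed.

Lemma ip_simple_sum (c : 'I_n -> F) i :
  ip e (character (M i)) (\sum_j c j *: character (M j)) = c i.
Proof.
rewrite ip_sumr (bigD1 i) //= (ip_irr e simple_system_enum) eqxx mulr1.
rewrite big1 ?addr0 // => j ji.
by rewrite (ip_irr e simple_system_enum) eq_sym (negPf ji) mulr0.
Qed.

Lemma simple_sum_inj (c d : 'I_n -> F) :
  \sum_j c j *: character (M j) = \sum_j d j *: character (M j) -> c =1 d.
Proof. by move=> E i; rewrite -(ip_simple_sum c i) E ip_simple_sum. Qed.

Lemma regular_simple_sum :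
  character (regular A) = \sum_i (\dim {:M i})%:R *: character (M i).
Proof.
rewrite (character_regular e simple_system_enum).
by apply: eq_bigr => i _; rewrite character1.
Qed.

Lemma hdimC (X : lmodule A) i : hdim e X (M i) = hdim e (M i) X.
Proof.
apply/eqP; rewrite -(Num.Theory.eqr_nat F) -!ip_character.
by rewrite (ip_irrC e simple_system_enum X i).
Qed.

Lemma ip_hdim (X Y : lmodule A) :
  hdim e Y X = (\sum_i hdim e X (M i) * hdim e Y (M i))%N.
Proof.
apply/eqP; rewrite -(Num.Theory.eqr_nat F) -ip_character {1}(character_hdim X).
rewrite ip_suml natr_sum; apply/eqP; apply: eq_bigr => i _.
by rewrite natrM ip_character.
Qed.

End CharacterSums.

Lemma simple_system_exists (F : numClosedFieldType) (A : falgType F)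
    (e : separability A) :
  exists n (M : 'I_n -> lmodule A), simple_system M.
Proof.
have [n [irr irrP]] := irr_enum_exists e.
have /choice[M MP] i : exists M : lmodule A, simple_module M /\ character M =
  irr i.
  by have [M ?] := irr_Irr irrP i; exists M.
exists n, M; split=> [i|i j|f /irrP.2[i <-]]; first by case: (MP i).
  by case: (MP i) (MP j) => _ -> [_ ->] /irrP.1.
by exists i; case: (MP i).
Qed.

Section RegularMultiplicity.
Variables (F : numClosedFieldType) (H : hopfAlgType F) (K : {aspace H}).
Hypothesis hK : hopf_subalgebra K.
Local Notation swK := (sub_sweedler hK).
Local Notation rmod := (res_module (mem1K hK)).
Local Notation X := (rmod (regular H)).
Variable t : subvs_of K.
Hypothesis tI : forall a, a * t = (eps swK a : F) *: t.
Hypothesis t1 : eps swK t = 1.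
Local Notation eK := (integral_separability tI t1).
Variables (m : nat) (V : 'I_m -> lmodule (subvs_of K)).
Hypothesis VS : simple_system V.

Local Notation w := (fun a => hdim eK X (V a)).
Local Notation d := (fun a => \dim {:V a}).

Lemma tens_multiplicity (Y : lmodule (subvs_of K)) (u : 'I_m -> nat) :
  character Y = \sum_a (u a)%:R *: character (V a) ->
  (forall k, character (tensm swK Y X) k = (\dim {:H})%:R * character Y k) ->
  forall a, (\sum_b u b * hdim eK (tensm swK (V b) X) (V a))%N = (\dim {:H} * u
    a)%N.
Proof.
move=> Yu YX a; apply/eqP; rewrite -(Num.Theory.eqr_nat F); apply/eqP.
rewrite natr_sum natrM.
transitivity (ip eK (character (V a)) (character (tensm swK Y X))).
  have -> : character (tensm swK Y X) =
      \sum_b (u b)%:R *: character (tensm swK (V b) X).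
    apply/lfunP => k; rewrite character_tensm sum_lfunE.
    under [RHS]eq_bigr => b _ do rewrite scale_lfunE character_tensm
      scaler_sumr.
    rewrite [RHS]exchange_big; apply: eq_bigr => p _.
    rewrite Yu sum_lfunE mulr_suml; apply: eq_bigr => b _.
    by rewrite scale_lfunE scalerAl.
  by rewrite ip_sumr; apply: eq_bigr => b _; rewrite natrM ip_character.
have -> : character (tensm swK Y X) = \sum_b ((\dim {:H})%:R * (u b)%:R) *:
  character (V b).
  apply/lfunP => k; rewrite YX Yu !sum_lfunE mulr_sumr; apply: eq_bigr => b _.
  by rewrite !scale_lfunE -[LHS]/(_ * (_ * _)) mulrA.
by rewrite (ip_simple_sum eK VS).
Qed.

(* [K (x) X] and [X (x) X] have characters [dim H] times those of [K] and [X], *)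
(* so both are eigenvectors of the strictly positive matrix [N]: Perron gives  *)
(* the proportionality that Nichols-Zoeller would provide.                     *)
Lemma regular_multiplicity a : (w a * \dim K = \dim {:H} * d a)%N.
Proof.
pose N b c := hdim eK (tensm swK (V b) X) (V c).
have Nw c : (\sum_b w b * N b c)%N = (\dim {:H} * w c)%N.
  apply: (tens_multiplicity (Y := X)); first exact: character_hdim.
  exact: character_res_regular_tens.
have Nd c : (\sum_b d b * N b c)%N = (\dim {:H} * d c)%N.
  apply: (tens_multiplicity (Y := regular (subvs_of K))).
    exact: (regular_simple_sum eK VS).
  by move=> k; rewrite character_regular_tens character1.
have d0 b : (0 < d b)%N by exact: simple_dim.
have [i0 i0max] := ratio_argmax w d0 a.
have prop b : (w b * d i0 = w i0 * d b)%N.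
  by apply: (ratio_max_closed Nd Nw i0max);
    rewrite /N hdimC // hdim_res_regular_gt0.
have dimH : (\sum_b w b * d b)%N = \dim {:H}.
  apply/eqP; rewrite -(Num.Theory.eqr_nat F) natr_sum -(character1 X).
  rewrite (character_hdim eK VS X) sum_lfunE; apply/eqP; apply: eq_bigr => b _.
  by rewrite scale_lfunE character1 natrM.
have dimK : (\sum_b d b * d b)%N = \dim K.
  have := character1 (regular (subvs_of K)); rewrite (regular_simple_sum eK VS).
  rewrite sum_lfunE [X in _ = X%:R](_ : _ = \dim K); last by rewrite dimvf.
  move=> E; apply/eqP; rewrite -(Num.Theory.eqr_nat F) natr_sum -E.
  by apply/eqP; apply: eq_bigr => b _; rewrite scale_lfunE character1 natrM.
(* Degree-weighted sums fix the factor: w gives dim H and d gives dim K. *)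
have E0 : (w i0 * \dim K = \dim {:H} * d i0)%N.
  rewrite -dimK -dimH big_distrr big_distrl /=; apply: eq_bigr => b _.
  by rewrite mulnA -prop mulnAC.
apply/eqP; rewrite -(eqn_pmul2r (d0 i0)); apply/eqP.
by rewrite mulnAC prop mulnAC E0 mulnAC.
Qed.

End RegularMultiplicity.

(** * Clifford theory for K in H *)

Section CliffordTheory.
Variables (F : numClosedFieldType) (H : hopfAlgType F) (K : {aspace H}).
Hypothesis hK : hopf_subalgebra K.
Hypothesis nK : normal_subspace K.

Local Notation sw := (hopf_sweedler H).
Local Notation swK := (sub_sweedler hK).
Local Notation rmod := (res_module (mem1K hK)).
Local Notation epsH := (eps sw).

Variable eH : separability H.
Variable t : subvs_of K.
Hypothesis tI : forall a, a * t = (eps swK a : F) *: t.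
Hypothesis t1 : eps swK t = 1.
Local Notation eK := (integral_separability tI t1).

Variables (W : {vspace regular H}) (sW : submodule W) (e : H).
Hypothesis eW : e \in W.
Hypothesis e1 : 1 - e \in augmentation_ideal K.
Hypothesis epsW : forall k w, k \in K -> w \in W -> k * w = (epsH k : F) *: w.

Variables (n : nat) (M : 'I_n -> lmodule H) (MS : simple_system M).
Variables (m : nat) (V : 'I_m -> lmodule (subvs_of K)) (VS : simple_system V).

Definition res_mult a j := hdim eK (rmod (M j)) (V a).
Local Notation q := res_mult.
Local Notation p := (fun j => \dim {:M j}).

Lemma res_simple j :
  res K (character (M j)) = \sum_a (q a j)%:R *: character (V a).
Proof. by rewrite -(character_res (mem1K hK)) (character_hdim eK VS). Qed.

Lemma res_simple_sum (c : 'I_n -> F) :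
  res K (\sum_i c i *: character (M i)) =
  \sum_a (\sum_i c i * (q a i)%:R) *: character (V a).
Proof.
have resl : linear (@res F H K).
  move=> k f g; apply/lfunP => x.
  by rewrite add_lfunE scale_lfunE !comp_lfunE add_lfunE scale_lfunE.
rewrite (linear_fun_sum resl); under [RHS]eq_bigr => a _ do rewrite scaler_suml.
rewrite [RHS]exchange_big; apply: eq_bigr => i _ /=.
rewrite (linear_funZ resl) res_simple scaler_sumr.
by apply: eq_bigr => a _; rewrite scalerA.
Qed.

Let N i j := hdim eH (tensm sw (submod sW) (M j)) (M i).

Lemma tens_dim j : (\sum_i p i * N i j = \dim W * p j)%N.
Proof.
apply/eqP; rewrite -(Num.Theory.eqr_nat F) natrM -(character1 (M j)).
rewrite -(character_quotient_tens hK sW epsW) ?mem1K //.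
rewrite (character_hdim eH MS) sum_lfunE natr_sum; apply/eqP;
  apply: eq_bigr => i _.
by rewrite scale_lfunE character1 natrM mulrC.
Qed.

Lemma tens_res_mult a j : (\sum_i q a i * N i j = \dim W * q a j)%N.
Proof.
apply/eqP; rewrite -(Num.Theory.eqr_nat F) natrM natr_sum.
pose T := tensm sw (submod sW) (M j).
have E : res K (character T) = (\dim W)%:R *: res K (character (M j)).
  rewrite -!(character_res (mem1K hK)); apply/lfunP => k.
  by rewrite scale_lfunE !res_moduleK (character_quotient_tens hK sW epsW)
    ?subvsP.
move: E; rewrite (character_hdim eH MS T) res_simple_sum res_simple scaler_sumr.
under [RHS]eq_bigr => b _ do rewrite scalerA.
move=> /(simple_sum_inj eK VS)/(_ a) => <-; apply/eqP; apply: eq_bigr => i _.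
by rewrite natrM mulrC.
Qed.

Definition share i j : Prop := (0 < hdim eK (rmod (M j)) (rmod (M i)))%N.

Lemma shareP i j : share i j <-> exists a, (0 < q a i)%N && (0 < q a j)%N.
Proof.
rewrite /share (ip_hdim eK VS); split=> [|[a aij]].
  move=> s; apply: contrapT => nex; move: s; rewrite big1 // => a _.
  have [qj|qj] := posnP (hdim eK (rmod (M i)) (V a)); first by rewrite qj mul0n.
  have [qi|qi] := posnP (hdim eK (rmod (M j)) (V a)); first by rewrite qi muln0.
  by case: nex; exists a; rewrite /q qi qj.
by rewrite (bigD1 a) //= ltn_addr // muln_gt0.
Qed.

Lemma share_sym i j : share i j -> share j i.
Proof. by move/shareP => [a]; rewrite andbC => ?; apply/shareP; exists a. Qed.

Lemma tens_gt0 i j : share i j -> (0 < N i j)%N.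
Proof.
move=> /hdim_gt0P[phi phii phi0].
rewrite /N; apply: (@hdim_quotient_tens _ _ _ hK eH W sW e eW e1 (M i) (M j)
  phi) => // k x kK.
by have := phii (Subvs kK) x; rewrite !res_moduleE.
Qed.

Lemma p_gt0 i : (0 < p i)%N. Proof. exact: (simple_dim MS). Qed.

(** At an i0 maximizing q_a / p, q_a is positive, so i and i0 share the constituent a. Then [N i i0]
    is positive and the maximum is also attained at i. *)
Lemma res_mult_max a i : (0 < q a i)%N -> forall k, (q a k * p i <= q a i * p
  k)%N.
Proof.
move=> qi k; have [i0 i0max] := ratio_argmax (q a) p_gt0 i.
have qi0 : (0 < q a i0)%N.
  have : (0 < q a i * p i0)%N by rewrite muln_gt0 qi p_gt0.
  by move=> /leq_trans/(_ (i0max i)); rewrite muln_gt0 => /andP[].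
have Ni : (0 < N i i0)%N by apply/tens_gt0/shareP; exists a; rewrite qi qi0.
have E := ratio_max_closed tens_dim (tens_res_mult a) i0max Ni.
rewrite -(leq_pmul2r (p_gt0 i0)) mulnAC [X in (_ <= X)%N]mulnAC E.
by rewrite [X in (_ <= X)%N]mulnAC leq_mul2r i0max orbT.
Qed.

(* Perron applied to [N i j], the multiplicity of [M i] in [(H // K) (x) M j], *)
(* with eigenvectors [p] and [q a].                                            *)
Lemma share_proportional i j a : share i j -> (q a j * p i = q a i * p j)%N.
Proof.
have key i' j' : share i' j' -> (0 < q a i')%N -> (q a j' * p i' = q a i' * p
  j')%N.
  move=> s qi; apply: (ratio_max_closed tens_dim (tens_res_mult a)
    (res_mult_max qi)).
  exact/tens_gt0/share_sym.
move=> s; have [qi|qi] := posnP (q a i); last exact: key.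
have [qj|qj] := posnP (q a j); first by rewrite qi qj !mul0n.
by rewrite (key j i) //; exact: share_sym.
Qed.

Lemma share_gt0 i j a : share i j -> (0 < q a i)%N = (0 < q a j)%N.
Proof.
move=> s; have := share_proportional a s => /(congr1 (fun x => 0 < x)%N).
by rewrite !muln_gt0 !p_gt0 !andbT.
Qed.

(** Proportional restrictions have the same constituents, so one common to j and k occurs in i
    too. *)
Lemma share_trans i j k : share i j -> share j k -> share i k.
Proof.
move=> ij /shareP[a /andP[aj ak]]; apply/shareP; exists a.
by rewrite ak andbT (share_gt0 a ij).
Qed.

Lemma res_mult_dim j : (\sum_a q a j * \dim {:V a} = p j)%N.
Proof.
apply/eqP; rewrite -(Num.Theory.eqr_nat F) natr_sum -(character1 (M j)).
have -> : character (M j) 1 = res K (character (M j)) 1.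
  by rewrite -(character_res (mem1K hK)) !character1.
rewrite res_simple sum_lfunE; apply/eqP; apply: eq_bigr => a _.
by rewrite natrM scale_lfunE character1.
Qed.

Lemma share_refl i : share i i.
Proof.
apply/shareP; apply: contrapT => nex; have := p_gt0 i;
  rewrite -res_mult_dim big1 // => a _.
apply/eqP; rewrite muln_eq0; apply/orP; left; rewrite -leqn0 leqNgt;
  apply/negP => qa.
by apply: nex; exists a; rewrite qa.
Qed.

(** Both sides count [V a] in H restricted to K: decompose H over itself first, or apply
    [regular_multiplicity]. *)
Lemma sum_res_mult a : (\sum_j p j * q a j * \dim K = \dim {:H} * \dim {:V
  a})%N.
Proof.
rewrite -big_distrl /= -(regular_multiplicity tI t1 VS); congr (_ * _)%N.
apply/eqP; rewrite -(Num.Theory.eqr_nat F) natr_sum -ip_character.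
rewrite (character_res (mem1K hK)) (regular_simple_sum eH MS).
rewrite res_simple_sum.
by rewrite (ip_simple_sum eK VS); apply/eqP; apply: eq_bigr => i _;
  rewrite natrM.
Qed.

Lemma res_mult_exists a : exists j, (0 < q a j)%N.
Proof.
apply: contrapT => nex; have := sum_res_mult a; rewrite big1 => [/esym/eqP|j _].
  rewrite muln_eq0 => /orP[|]; last by rewrite -leqn0 leqNgt (simple_dim VS).
  by rewrite -leqn0 leqNgt; have := adim_gt0 {:H}%AS => ->.
case: (posnP (q a j)) => [->|qj]; first by rewrite muln0 mul0n.
by case: nex; exists j.
Qed.

(** Only the class of j contributes to [sum_res_mult], as any k containing a shares it with j; on
    that class p_j q_ak = p_k q_aj, which isolates q_aj. *)
Lemma res_mult_class (D : pred 'I_n) j a :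
  (forall k, D k <-> share k j) -> (0 < q a j)%N ->
  (q a j * (\sum_(k | D k) p k * p k) * \dim K = p j * (\dim {:H} * \dim {:V
    a}))%N.
Proof.
move=> Dj qj; rewrite -sum_res_mult -big_distrl /= mulnA; congr (_ * _)%N.
rewrite [in RHS](bigID D) /= [X in (_ + X)%N]big1 => [|k nD]; last first.
  case: (posnP (q a k)) => [->|qk]; first by rewrite muln0.
  by case/negP: nD; apply/Dj/shareP; exists a; rewrite qk qj.
rewrite addn0 !big_distrr /=; apply: eq_bigr => k /Dj kj.
have /= E := share_proportional a kj.
by rewrite mulnA E mulnAC mulnC; congr (_ * _)%N; exact: mulnC.
Qed.

Lemma ip_res_share i j :
  share i j <-> ip eK (res K (character (M i))) (res K (character (M j))) != 0.
Proof.
by rewrite -!(character_res (mem1K hK)) ip_character /share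
  Num.Theory.pnatr_eq0 lt0n.
Qed.

Lemma coset_relP i j :
  coset_rel K (character (M i)) (character (M j)) <-> share i j.
Proof.
split=> [[M' [N' [[sM' cM'] [sN' cN'] sub]]]|s].
  (* [coset_rel] supplies arbitrary modules with the given characters; [share] is therefore first
     expressed through characters. *)
  apply/ip_res_share; rewrite -cM' -cN' -!(character_res (mem1K hK))
    ip_character.
  rewrite Num.Theory.pnatr_eq0 -lt0n.
  apply: (hdim_gt0_of_coefs sub); rewrite Num.Theory.pnatr_eq0 -lt0n.
  apply: (@hdim_gt0 _ _ eK _ _ (\1%VF : 'Hom(rmod M', rmod M'))).
    by move=> a x; rewrite !id_lfunE.
  apply/eqP => /(congr1 (fun f : 'End(M') => lfun_trace f)) /eqP.
  rewrite lfun_trace_id linear0 Num.Theory.pnatr_eq0 -leqn0 leqNgt.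
  by rewrite (simple_dim_gt0 sM').
have [sM _ _] := MS; exists (M i), (M j); split=> //.
move: s => /hdim_gt0P[phi phii phi0].
apply: (coefs_sub_convolutionv hK nK (phi := phi)) => // k x kK.
by have := phii (Subvs kK) x; rewrite !res_moduleE.
Qed.

(** Frobenius reciprocity: row a of the restriction matrix lists the multiplicities of the induced
    module. *)
Lemma character_induced_mult (U : lmodule (subvs_of K)) a :
  character U = character (V a) ->
  character (induced U) = \sum_j (q a j)%:R *: character (M j).
Proof.
move=> Ua; rewrite (character_hdim eH MS); apply: eq_bigr => j _.
rewrite (hdim_induced (mem1K hK) eH eK) /q -ip_character Ua ip_character.
by congr (_%:R *: _); rewrite (hdimC eK VS).
Qed.

End CliffordTheory.

(** * The partition of Irr(K) and the character formulas *)

Local Open Scope classical_set_scope.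

Lemma fsbig_enum (U : zmodType) (T : choiceType) n (f : 'I_n -> T) (D : set T)
    (g : T -> U) :
  injective f -> (forall x, D x -> exists i, f i = x) ->
  \sum_(x \in D) g x = \sum_(i | `[< D (f i) >]) g (f i).
Proof.
move=> fi Df; rewrite (fsbigE [seq f i | i <- enum 'I_n & `[< D (f i) >]]).
- rewrite big_map big_filter_cond big_enum_cond /=; apply: eq_bigl => i.
  by rewrite -[f i \in D]/(`[< D (f i) >]) andbb.
- by rewrite map_inj_uniq // filter_uniq // enum_uniq.
- by move=> _ /= /mapP[j +] ->; rewrite mem_filter => /andP[/asboolP].
move=> x Dx; have [j fx] := Df x Dx; case/negP; rewrite -fx map_f // mem_filter.
by rewrite mem_enum andbT; apply/asboolP; rewrite fx.
Qed.

Theorem mainTheorem3 (R : realType) (H : hopfAlgType R[i]) (K : {aspace H})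
    (l : nat) (C : 'I_l -> set (dual H)) :
  semisimple_algebra H ->
  hopf_subalgebra K ->
  normal_subspace K ->
  injective C ->
  range C = coset_class K @` Irr H ->
  let a (i : 'I_l) : dual H := \sum_(chi \in C i) chi 1 *: chi in
  let r : R[i] := (\dim {:H})%:R / (\dim K)%:R in
  exists A : 'I_l -> set (dual (subvs_of K)),
    partition [set: 'I_l] A (Irr (subvs_of K)) /\
    forall i : 'I_l,
      [/\ res K (a i) = r *: \sum_(alpha \in A i) alpha 1 *: alpha,
          a i 1 = r * \sum_(alpha \in A i) alpha 1 ^+ 2,
          forall chi, C i chi ->
            res K chi =
              (chi 1 / a i 1 * r) *: \sum_(alpha \in A i) alpha 1 *: alpha &
          forall alpha, A i alpha ->
          forall M : lmodule (subvs_of K), character M = alpha ->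
            character (induced M) =
              (alpha 1 / a i 1 * r) *: \sum_(chi \in C i) chi 1 *: chi /\
            character (induced M) = (alpha 1 / a i 1 * r) *: a i].
Proof.
move=> ssH hK nK Cinj Crange a r.
have [L [LI L1]] := semisimple_integral ssH.
pose eH := integral_separability LI L1.
have [t [tI t1]] := sub_integral ssH hK nK.
pose eK := integral_separability tI t1.
have [W [sW [e [eW e1 epsW]]]] := aug_compl ssH hK nK.
have [n [M MS]] := simple_system_exists eH.
have [m [V VS]] := simple_system_exists eK.
have [sM Minj Msur] := MS; have [sV Vinj Vsur] := VS.
pose q := res_mult tI t1 M V; pose p j := \dim {:M j}.
pose shr := share tI t1 M.
have p0 j : (0 < p j)%N by exact: (simple_dim MS).
have d0 b : (0 < \dim {:V b})%N by exact: (simple_dim VS).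
have sharegt0 i j b : shr i j -> (0 < q b i)%N = (0 < q b j)%N.
  exact: (share_gt0 eH sW eW e1 epsW MS VS).
have shareE i j : shr i j <-> exists b, (0 < q b i)%N && (0 < q b j)%N.
  exact: (shareP tI t1 M VS).
have ssym i j : shr i j -> shr j i by exact: (share_sym VS).
have strans i j k : shr i j -> shr j k -> shr i k.
  exact: (share_trans eH sW eW e1 epsW MS VS).
have srefl i : shr i i by exact: (share_refl tI t1 MS VS).
have cosetE i j : coset_rel K (character (M i)) (character (M j)) <-> shr i j.
  exact: (coset_relP nK tI t1 MS).
(* Each block is the coset class of some [M j0], rewritten in terms of [shr]. *)
have Crep i : exists j0, forall f, C i f <-> exists j, f = character (M j) /\
  shr j j0.
  have : range C (C i) by exists i.
  rewrite Crange => -[_ /Msur[j0 <-] <-]; exists j0 => f; split.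
    by move=> [/Msur[j <-] /cosetE s]; exists j.
  by move=> [j [-> s]]; split; [exists (M j)|apply/cosetE].
have CM i j0 : (forall f, C i f <-> exists j, f = character (M j) /\ shr j j0)
  ->
    forall j, C i (character (M j)) <-> shr j j0.
  move=> Ci j; rewrite Ci; split=> [[j' [/Minj -> ]]|s] //; by exists j.
have Cex j : exists i, C i (character (M j)).
  have : (coset_class K @` Irr H) (coset_class K (character (M j))).
    by exists (character (M j)) => //; exists (M j).
  rewrite -Crange => -[i _ Ci]; exists i; rewrite Ci; split;
    first by exists (M j).
  exact/cosetE.
have Cshare i j k : C i (character (M j)) -> C i (character (M k)) <-> shr k j.
  have [j0 /CM Ci] := Crep i; rewrite !Ci => jj0; split=> [kj0|kj].
    exact: strans kj0 (ssym _ _ jj0).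
  exact: strans kj jj0.
have CirrM i f : C i f -> exists j, character (M j) = f.
  by have [j0 ->] := Crep i => -[j [-> _]]; exists j.
have Cne i : exists j, C i (character (M j)).
  by have [j0 /CM Ci] := Crep i; exists j0; apply/Ci.
pose T i := (\sum_(k | `[< C i (character (M k)) >]) p k * p k)%N.
have aE i : a i = \sum_(k | `[< C i (character (M k)) >]) (p k)%:R *: character
  (M k).
  rewrite /a (fsbig_enum _ Minj (@CirrM i)).
  by apply: eq_bigr => k _; rewrite character1.
have a1 i : a i 1 = (T i)%:R.
  rewrite aE sum_lfunE natr_sum; apply: eq_bigr => k _.
  by rewrite scale_lfunE character1 natrM.
have T0 i : (T i)%:R != 0 :> R[i].
  have [j Cj] := Cne i; rewrite Num.Theory.pnatr_eq0 -lt0n /T (bigD1 j) /=.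
    by rewrite ltn_addr // muln_gt0 p0.
  exact/asboolP.
have K0 : (\dim K)%:R != 0 :> R[i].
  by rewrite Num.Theory.pnatr_eq0 -lt0n; exact: adim_gt0.
(* The constituents on K of the characters in the i-th class; by [Aq], each single member of the
   class contains all of them. *)
pose A i : set (dual (subvs_of K)) := [set f | exists b, f = character (V b) /\
  exists2 j, C i (character (M j)) & (0 < q b j)%N].
have AV i f : A i f -> exists b, character (V b) = f.
  by move=> [b [-> _]]; exists b.
have Aq i b j : C i (character (M j)) -> A i (character (V b)) <-> (0 < q b
  j)%N.
  move=> Cj; split=> [[b' [/Vinj <- [k Ck qk]]]|qj].
    by rewrite -(@sharegt0 k) //; apply/Cshare; first exact: Cj.
  by exists b; split=> //; exists j.
have qE i b j : C i (character (M j)) -> A i (character (V b)) ->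
    (q b j)%:R = (p j)%:R / a i 1 * r * (\dim {:V b})%:R :> R[i].
  move=> Cj /(Aq _ _ _ Cj) qj.
  have Dj k : `[< C i (character (M k)) >] <-> share tI t1 M k j.
    by split=> [/asboolP/(Cshare _ _ _ Cj)|/(Cshare _ _ _ Cj)/asboolP].
  have := res_mult_class eH sW eW e1 epsW MS VS
    (D := fun k => `[< C i (character (M k)) >]) Dj qj.
  move=> /(congr1 (fun x => x%:R : R[i])); rewrite !natrM => E.
  rewrite a1 /r; apply: (mulIf (T0 i)); apply: (mulIf K0).
  rewrite [LHS]E; field.
  by rewrite T0 K0.
have q0 i b j : C i (character (M j)) -> ~ A i (character (V b)) -> q b j = 0%N.
  move=> Cj nA; apply/eqP; rewrite -leqn0 leqNgt; apply/negP => qj; apply: nA.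
  exact/(Aq _ _ _ Cj).
have sumA i : \sum_(alpha \in A i) alpha 1 *: alpha =
    \sum_(b | `[< A i (character (V b)) >]) (\dim {:V b})%:R *: character (V b).
  rewrite (fsbig_enum _ Vinj (@AV i)).
  by apply: eq_bigr => b _; rewrite character1.
have resC i j : C i (character (M j)) -> res K (character (M j)) =
    ((p j)%:R / a i 1 * r) *: \sum_(alpha \in A i) alpha 1 *: alpha.
  move=> Cj; rewrite sumA (res_simple tI t1 M VS) scaler_sumr.
  rewrite (bigID (fun b => `[< A i (character (V b)) >])) /= [X in _ + X]big1;
    last first.
    by move=> b /asboolPn nA; rewrite -/(q b j) (q0 i) // scale0r.
  by rewrite addr0; apply: eq_bigr => b /asboolP Ab;
    rewrite -/(q b j) (qE i) // scalerA.
have resa i : res K (a i) = r *: \sum_(alpha \in A i) alpha 1 *: alpha.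
  have resl : linear (@res _ H K).
    move=> k f g; apply/lfunP => x.
    by rewrite add_lfunE scale_lfunE !comp_lfunE add_lfunE scale_lfunE.
  rewrite aE -big_filter (linear_fun_sum resl) big_filter.
  under eq_bigr => k /asboolP Ck do rewrite (linear_funZ resl) (resC i) //
    scalerA.
  rewrite -scaler_suml; congr (_ *: _).
  transitivity (\sum_(k | `[< C i (character (M k)) >]) (p k * p k)%:R * (r / a
    i 1)).
    by apply: eq_bigr => k _; rewrite natrM; ring.
  by rewrite -mulr_suml -natr_sum -/(T i) a1 mulrCA divff ?mulr1.
exists A; split; last first.
  move=> i; split.
  - exact: resa.
  - have -> : a i 1 = res K (a i) 1.
      rewrite comp_lfunE; congr (a i _); rewrite [RHS]lfunE.
      exact/esym/(sub_val1 hK).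
    rewrite resa scale_lfunE sumA sum_lfunE; congr (_ * _).
    rewrite (fsbig_enum _ Vinj (@AV i)); apply: eq_bigr => b _.
    by rewrite scale_lfunE character1 expr2.
  - move=> chi Cchi; have [j Mj] := CirrM _ _ Cchi.
    by rewrite -Mj character1 (resC i) // Mj.
  move=> alpha Aalpha U Ualpha.
  suff indE : character (induced U) = (alpha 1 / a i 1 * r) *: a i by [].
  have [b Vb] := AV _ _ Aalpha.
  rewrite (character_induced_mult eH tI t1 MS VS (a := b)) ?Ualpha // -Vb.
  rewrite [X in _ = _ *: X]aE scaler_sumr (bigID (fun k => `[< C i (character
    (M k)) >])) /=.
  rewrite [X in _ + X]big1 ?addr0; last first.
    (* A k outside the class cannot contain b, for it would share b with a member of the class. *)
    move=> k /asboolPn nC; rewrite -/(q b k).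
    move: Aalpha; rewrite -Vb => -[b' [/Vinj <- [j Cj qj]]].
    case: (posnP (q b k)) => [->|qk]; first by rewrite scale0r.
    by case: nC; apply/(Cshare _ _ _ Cj)/shareE; exists b; rewrite qk.
  apply: eq_bigr => k /asboolP Ck; rewrite -/(q b k) (qE i) ?Vb // scalerA.
  by congr (_ *: _); rewrite -Vb character1; ring.
split.
- rewrite /cover; apply/seteqP; split=> [f [i _ [b [-> _]]]|f /Vsur[b <-]].
    by exists (V b).
  have [j qj] := res_mult_exists eH tI t1 MS VS b.
  have [i Ci] := Cex j; exists i => //; exists b; split=> //; exists j => //.
(* A constituent common to two blocks makes members of the two classes equivalent; the classes
   coincide, and [C] is injective. *)
- move=> i i' _ _ [f [[b [fb [j Cj qj]]] [b' [fb' [j' Cj' qj']]]]].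
  have bb : b = b' by apply: Vinj; rewrite -fb -fb'.
  apply: Cinj; apply/seteqP.
  have sjj : shr j j' by apply/shareE; exists b; rewrite qj bb qj'.
  split=> g Cg; have [k Mk] := CirrM _ _ Cg; rewrite -Mk.
    apply/(Cshare _ _ _ Cj'); apply: strans sjj; apply/(Cshare _ _ _ Cj).
    by rewrite Mk.
  apply/(Cshare _ _ _ Cj); apply: strans (ssym _ _ sjj);
    apply/(Cshare _ _ _ Cj').
  by rewrite Mk.
(* [partition] also requires every block to be nonempty. *)
move=> i _; have [j Cj] := Cne i.
have /shareE[b /andP[qb _]] := srefl j.
by exists (character (V b)), b; split=> //; exists j.
Qed.
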